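(* Let $m\ge 2$ and $n\ge 1$ be integers, let $N=\{1,\ldots,n\}$, and let $\mathcal{A}=(a_{i_1\cdots i_m})$ be a real $m$-th order $n$-dimensional tensor. Suppose that there exists an index subset $J_0\subseteq N$ with $|J_0|=l$ such that $a_{ii_2\cdots i_m}>0$ for any $i\in J_0$ and any $i_2,\ldots,i_m\in N\setminus\{i\}$. Then $\mathcal{A}$ has at most $$\gamma^l_{m,n}:=[n(m-1)+l](m-1)^{l-1}m^{n-l-1}$$ Pareto-eigenvalues. In particular, if $J_0=N$, then $\mathcal{A}$ has at most $\mu_{m,n}:=n(m-1)^{n-1}$ Pareto-eigenvalues.
   Context: A real $m$-th order $n$-dimensional tensor is an array $\mathcal{A}=(a_{i_1\cdots i_m})$ with $a_{i_1\cdots i_m}\in\mathbb{R}$ for $1\le i_1,\ldots,i_m\le n$. For $x\in\mathbb{R}^n$, $\mathcal{A}x^{m-1}\in\mathbb{R}^n$ is the vector with $(\mathcal{A}x^{m-1})_i=\sum_{i_2,\ldots,i_m=1}^n a_{ii_2\cdots i_m}x_{i_2}\cdots x_{i_m}$, and $x^{[m-1]}=(x_1^{m-1},\ldots,x_n^{m-1})^\top$. Vector inequalities are componentwise. A Pareto-eigenvalue of $\mathcal{A}$ is a real number $\lambda$ for which there exists $x\in\mathbb{R}^n\setminus\{0\}$ with $x\ge 0$, $\lambda x^{[m-1]}-\mathcal{A}x^{m-1}\ge 0$ and $\langle x,\lambda x^{[m-1]}-\mathcal{A}x^{m-1}\rangle=0$. The exponents $l-1$ and $n-l-1$ in $\gamma^l_{m,n}$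 may equal $-1$; the expression is then read as a rational number (its value is always an integer). *)

(* Defs.v *)
From HB Require Import structures.
From mathcomp Require Import all_boot all_order all_algebra.
From mathcomp Require Import finmap.
From mathcomp Require Import boolp classical_sets functions cardinality reals.

Set Implicit Arguments.
Unset Strict Implicit.
Unset Printing Implicit Defensive.

Import Order.TTheory GRing.Theory Num.Theory.
Local Open Scope ring_scope.

(* Entry a_{i_1 ... i_m} is [A [tuple i_1; ...; i_m]]. *)
Definition tensor (R : Type) (m n : nat) := m.-tuple 'I_n -> R.

Section Pareto.
Context {R : realType} {m n : nat}.
Implicit Types (A : tensor R m n) (x y : 'cV[R]_n) (lambda : R).

(* A x^{m-1}.  For m >= 1 the tuples [t] with [ohead t == Some i] are exactly
   (i, i_2, ..., i_m), and [behead t] is then (i_2, ..., i_m). *)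
Definition tensor_app A x : 'cV[R]_n :=
  \col_i \sum_(t : m.-tuple 'I_n | ohead t == Some i)
    A t * \prod_(j <- behead t) x j 0.

(* x^{[m-1]} *)
Definition vpow x : 'cV[R]_n := \col_i x i 0 ^+ (m - 1).

Definition vge0 x : Prop := forall i, 0 <= x i 0.

Definition inner x y : R := \sum_i x i 0 * y i 0.

Definition pareto_eigenvalue A lambda : Prop :=
  exists x, [/\ x != 0, vge0 x,
    vge0 (lambda *: vpow x - tensor_app A x) &
    inner x (lambda *: vpow x - tensor_app A x) = 0].

Definition pareto_spectrum A : set R := [set lambda | pareto_eigenvalue A lambda]%classic.

(* a_{i i_2 ... i_m} > 0 for all i in J and i_2, ..., i_m in N \ {i}. *)
Definition positive_off A (J : {set 'I_n}) : Prop :=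
  forall (i : 'I_n) (t : m.-tuple 'I_n),
    i \in J -> ohead t = Some i -> i \notin behead t -> 0 < A t.

End Pareto.

Definition at_most_elements {T : choiceType} (S : set T) (c : rat) : Prop :=
  finite_set S /\ (#|` fset_set S|%fset)%:R <= c.

(* Rational-valued, with integer exponents, since l - 1 and n - l - 1 may be -1. *)
Definition gamma (m n l : nat) : rat :=
  (n%:R * (m%:R - 1) + l%:R) * (m%:R - 1) ^ (l%:Z - 1)
    * m%:R ^ (n%:Z - l%:Z - 1).

Definition mu (m n : nat) : nat := (n * (m - 1) ^ (n - 1))%N.

(* Main.v *)
Require Import Defs.
From mathcomp Require Import all_boot all_order all_algebra.
From mathcomp Require Import reals.
From HB Require Import structures.
From mathcomp Require Import finmap perm fraction generic_quotient mpoly.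
From mathcomp Require Import boolp zify ring.
From mathcomp Require classical_sets cardinality.

(** Put [d = m - 1].  If [x >= 0] is a Pareto eigenvector with support [J], then
    [J0] is contained in [J], since otherwise [(A x^d)_i > 0 = lambda x_i^d] for
    some [i] in [J0]; and the restriction of [x] to [J] is an eigenvector, without
    zero coordinate, of the principal subtensor of [A] on [J].  The bound is the
    sum over [J] containing [J0] of the number [k d^(k-1)], [k = #|J|], of
    eigenvalues of the latter.

    To get [k d^(k-1)] for forms [F_1, ..., F_k] of degree [d], work with the
    monomials of degree [k (d - 1) + 1].  Each is divisible by some [x_i^d], and
    exactly [k d^(k-1)] of them ("reduced") by only one.  Modulo the minors
    [x_p^d F_q - x_q^d F_p], multiplication by [lambda] is the operator replacing a
    factor [x_i^d] by [F_i].  Writing the minors on the nonreduced monomials and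
    [lambda - (this operator)] on the reduced ones gives a matrix [Nmx], whose
    determinant [p] vanishes at the eigenvalues, and has degree [k d^(k-1)] and
    leading coefficient [delta = det Tmx].  For generic forms [p / delta] divides
    the characteristic polynomial of the operator on all monomials, because by
    Eagon-Northcott relations the minors of [Tmx] span all of them.

    [F] itself may have [delta = p = 0], so it is deformed to [F + t (D - F) + u (G - F)],
    where [D] is diagonal and [G] has [delta <> 0] and shares a given eigenpair with [F].
    By Gauss's lemma the monic [p / delta] has no pole in [u] over the field of
    rational functions of [t], nor along [t = 0], so it can be evaluated at
    [t = u = 0].  On [t = 0] it keeps the eigenvalue as a root, while on
    [u = 0] it does not depend on the eigenpair. *)

Set Implicit Arguments.
Unset Strict Implicit.
Unset Printing Implicit Defensive.
Import Order.TTheory GRing.Theory Num.Theory.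
Local Open Scope ring_scope.
Local Notation tofrac := (@FracField.tofrac _).

(** * Gauss's lemma *)

Lemma irreducible_factor (F : fieldType) (a : {poly F}) :
  (1 < size a)%N -> exists2 pi, irreducible_poly pi & pi %| a.
Proof.
elim: {a}(size a) {-2}a (leqnn (size a)) => [|n IH] a ha a1; first by lia.
have [ia|nia] := EM (irreducible_poly a); first by exists a.
have [q [q1 qa nqa]] : exists q : {poly F}, [/\ size q != 1%N, q %| a & ~~ (q %= a)].
  apply: contrapT => h; apply: nia; split=> // q q1 qa.
  by apply: contrapT => nqa; apply: h; exists q; split=> //; apply/negP.
have a0 : a != 0 by rewrite -size_poly_gt0; lia.
have sq : (size q < size a)%N.
  rewrite ltn_neqAle dvdp_leq // andbT.
  by apply: contra nqa => /eqP e; rewrite -dvdp_size_eqp // e.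
have q0 : (0 < size q)%N.
  rewrite size_poly_gt0; apply: contraTneq qa => ->.
  by rewrite dvd0p.
have [pi ipi pq] := IH q ltac:(lia) ltac:(lia).
by exists pi => //; apply: dvdp_trans pq qa.
Qed.

Lemma irreducible_dvdM (F : fieldType) (pi a b : {poly F}) :
  irreducible_poly pi -> pi %| a * b -> (pi %| a) || (pi %| b).
Proof.
move=> ipi h; case: (boolP (pi %| a)) => //= na.
by rewrite -(Gauss_dvdpr _ (_ : coprimep pi a)) // irreducible_poly_coprime.
Qed.

Lemma scale_of_coef_dvd (F : fieldType) (c : {poly F}) (p : {poly {poly F}}) :
  (forall i, c %| p`_i) -> exists p', p = c *: p'.
Proof.
move=> h; exists (\poly_(i < size p) (p`_i %/ c)); apply/polyP=> i.
rewrite coefZ coef_poly; case: ltnP => hi; first by rewrite mulrC divpK.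
by rewrite nth_default ?mulr0.
Qed.

(** If [i] and [j] are the least indices of coefficients of [p] and [q] not divisible by [c], then
    the coefficient of [p * q] at [i + j] is [p_i q_j] modulo [c], hence not divisible by [c]. *)
Lemma irreducible_dvd_polyM (F : fieldType) (c : {poly F})
    (p q r : {poly {poly F}}) :
  irreducible_poly c -> p * q = c *: r ->
  (exists p', p = c *: p') \/ (exists q', q = c *: q').
Proof.
move=> ic e.
have [hp|hp] := EM (forall i, c %| p`_i); first by left; apply: scale_of_coef_dvd.
have [hq|hq] := EM (forall i, c %| q`_i); first by right; apply: scale_of_coef_dvd.
exfalso.
have ex (s : {poly {poly F}}) : ~ (forall i, c %| s`_i) -> exists i, ~~ (c %| s`_i).
  by move=> hs; apply: contrapT => h; apply: hs => i; apply: contraT => hi; case: h; exists i.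
case: (ex_minnP (ex _ hp)) => i ni mi; case: (ex_minnP (ex _ hq)) => j nj mj.
have hi (l : nat) : (l < i)%N -> c %| p`_l.
  by move=> li; apply: contraLR li => /mi; rewrite -leqNgt.
have hj (l : nat) : (l < j)%N -> c %| q`_l.
  by move=> li; apply: contraLR li => /mj; rewrite -leqNgt.
have : c %| p`_i * q`_j.
  have li : (i < (i + j).+1)%N by lia.
  have := congr1 (fun s : {poly {poly F}} => s`_(i + j)) e.
  rewrite coefM coefZ (bigD1 (Ordinal li)) //= addKn => e'.
  rewrite -(dvdp_addl _ (_ : c %| \sum_(l < (i + j).+1 | l != Ordinal li) p`_l * q`_(i + j - l))).
    by rewrite e' dvdp_mulr.
  elim/big_ind: _ => [||[l hl] /= nl]; [exact: dvdp0|by move=> x y hx hy; rewrite dvdp_add|].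
  have {nl} nl : l != i by apply: contraNneq nl => nl; apply/eqP/val_inj.
  have [li'|] := ltnP l i; first by rewrite dvdp_mulr // hi.
  by move=> li'; rewrite dvdp_mull // hj //; lia.
by move/(irreducible_dvdM ic); rewrite (negPf ni) (negPf nj).
Qed.

Lemma polyZI (D : idomainType) (c : D) : c != 0 -> injective ( *:%R c : {poly D} -> {poly D}).
Proof.
by move=> c0 p q; rewrite -!mul_polyC; apply: mulfI; rewrite polyC_eq0.
Qed.

(** Each irreducible factor of [a] divides [p] or [q] and is cancelled there. What remains is a
    factorization of [chi] up to a constant, whose leading coefficients are units; so [lead_coef p]
    is a content of [p]. *)
Lemma gauss_monic_factor (F : fieldType) (a : {poly F}) (p q chi : {poly {poly F}}) :
  a != 0 -> chi \is monic -> a *: chi = p * q -> exists P, p = lead_coef p *: P.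
Proof.
move=> a0 mchi e.
suff [c [P [pE uP]]] : exists c P, p = c *: P /\ lead_coef P \is a GRing.unit.
  exists ((lead_coef P)^-1 *: P).
  by rewrite {2}pE lead_coefZ scalerA mulrK.
elim: {a}(size a) {-2}a (leqnn (size a)) a0 p q e => [|n IH] a ha a0 p q e.
  by move: a0; rewrite -size_poly_gt0; lia.
have [a1|a1] := ltnP 1 (size a); last first.
  exists 1, p; rewrite scale1r; split=> //.
  have: lead_coef p * lead_coef q = a.
    by rewrite -lead_coefM -e lead_coefZ (monicP mchi) mulr1.
  have [b b0 ->] : exists2 b, b != 0 & a = b%:P.
    have /eqP/size_poly1P[b b0 ab] : size a = 1%N.
      by apply/eqP; rewrite eqn_leq a1 size_poly_gt0.
    by exists b.
  move=> h; apply/unitrP; exists (b^-1%:P * lead_coef q).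
  rewrite -mulrA [lead_coef q * _]mulrC h mulrCA h -polyCM.
  by rewrite mulVf.
have [c ic /dvdpP[a' aE]] := irreducible_factor a1.
have c0 : c != 0 by apply: contraTneq a0 => c0; rewrite aE c0 mulr0 eqxx.
have a'0 : a' != 0 by apply: contraTneq a0 => c0'; rewrite aE c0' mul0r eqxx.
have sa' : (size a' <= n)%N.
  have := ic.1; move: ha (a'0); rewrite aE size_mul // -[a' != 0]size_poly_gt0.
  by move: (size a') (size c) => u v; lia.
have e' : p * q = c *: (a' *: chi) by rewrite -e scalerA mulrC aE.
have [[p' pE]|[q' qE]] := irreducible_dvd_polyM ic e'.
  have e'' : a' *: chi = p' * q.
    by apply: (polyZI c0); rewrite -e' pE scalerAl.
  have [b [P [p'E uP]]] := IH a' sa' a'0 p' q e''; exists (c * b), P.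
  by rewrite pE p'E scalerA.
have e'' : a' *: chi = p * q'.
  by apply: (polyZI c0); rewrite -e' qE scalerAr.
exact: IH a' sa' a'0 p q' e''.
Qed.

Lemma fraction_num_den (D : idomainType) (x : {fraction D}) :
  exists a b : D, b != 0 /\ tofrac b * x = tofrac a.
Proof.
elim/quotW: x => y; exists (frac y).1, (frac y).2; split; first exact: denom_ratioP.
unlock tofrac; rewrite -[LHS]FracField.pi_mul.
apply/eqP; etransitivity; first exact: FracField.equivf_def.
rewrite /FracField.mulf.
by rewrite !numden_Ratio ?mulf_neq0 ?denom_ratioP ?oner_eq0 // mulr1 !mul1r; apply/eqP.
Qed.

Lemma clear_denominators (D : idomainType) (p : {poly {fraction D}}) :
  exists a p', a != 0 :> D /\ tofrac a *: p = map_poly tofrac p'.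
Proof.
elim/poly_ind: p => [|p c [a [p' [a0 e]]]].
  by exists 1, 0; rewrite oner_neq0 scaler0 rmorph0.
have [x [y [y0 e']]] := fraction_num_den c.
exists (a * y), (y *: p' * 'X + (a * x)%:P); rewrite mulf_neq0 //; split=> //.
rewrite [RHS]rmorphD [X in _ = X + _]rmorphM /= map_polyX map_polyC map_polyZ /= -e.
rewrite !rmorphM /= -e' scalerDr -!scalerAl scalerA.
congr (_ *: _ + _); first by rewrite mulrC.
by rewrite -mul_polyC -!polyCM -mulrA.
Qed.

Lemma clear_denominators2 (D : idomainType) (p : {poly {poly {fraction D}}}) :
  exists a p', a != 0 :> D /\
    (tofrac a)%:P *: p = map_poly (map_poly tofrac) p'.
Proof.
elim/poly_ind: p => [|p c [a [p' [a0 e]]]].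
  by exists 1, 0; rewrite oner_neq0 scaler0 rmorph0.
have [y [x [y0 e']]] := clear_denominators c.
exists (a * y), (y%:P *: p' * 'X + (a *: x)%:P); rewrite mulf_neq0 //; split=> //.
rewrite [RHS]rmorphD [X in _ = X + _]rmorphM /= map_polyX map_polyC map_polyZ /= -e.
rewrite map_polyC map_polyZ /= -e' scalerDr -!scalerAl scalerA -polyCM rmorphM /=.
rewrite [_ y * _ a]mulrC; congr (_ + _).
by rewrite -[LHS]mul_polyC -polyCM mul_polyC scalerA mulrC.
Qed.

(* With [t] the inner and [u] the outer variable, [p / lead_coef p] is polynomial
   in [u] over the rational functions of [t]; it has no pole along [t = 0], where
   its denominator does not vanish identically. *)
Lemma gauss_monic_factor2 (F : fieldType) (a : {poly {poly F}})
    (p q chi : {poly {poly {poly F}}}) :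
  a != 0 -> chi \is monic -> a *: chi = p * q ->
  map_poly (horner_eval 0) (lead_coef p) != 0 ->
  exists (g : {poly F}) P, g.[0] != 0 /\ g%:P *: p = lead_coef p *: P.
Proof.
move=> a0 mchi e d0.
(* Over the field of rational functions of [t], [gauss_monic_factor] applies with [u] as its
   variable. *)
pose i : {poly {poly F}} -> {poly {fraction {poly F}}} := map_poly tofrac.
have iI : injective i.
  by apply: map_inj_poly (tofrac0 _) => x y /eqP; rewrite tofrac_eq => /eqP.
have i0 : i 0 = 0 by apply: map_poly0.
have [P eP] : exists P, map_poly i p = lead_coef (map_poly i p) *: P.
  apply: (@gauss_monic_factor _ (i a) _ (map_poly i q) (map_poly i chi)).
  - by rewrite -i0 inj_eq.
  - by apply: monic_map.
  - by rewrite -rmorphM -e /= map_polyZ.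
rewrite lead_coef_map_inj // in eP.
have [g [P' [g0 e']]] := clear_denominators2 P.
have {eP e' P} eg : g%:P *: p = lead_coef p *: P'.
  have ig : i g%:P = (tofrac g)%:P by apply: map_polyC.
  have iZ (c : {poly {poly F}}) r : map_poly i (c *: r) = i c *: map_poly i r.
    exact: map_polyZ.
  apply: (map_inj_poly iI i0); rewrite !iZ -[map_poly i P']e' ig eP scalerA mulrC.
  by rewrite scalerA.
(* Powers of [t] are cancelled from [g] one at a time. If [g(0) = 0], reduction modulo [t] kills the
   left side of [eg] but not [lead_coef p], so [t] divides [P']. *)
elim: {g}(size g) {-2}g (leqnn (size g)) g0 P' eg => [|n IH] g hg g0 P' eg.
  by move: g0; rewrite -size_poly_gt0; lia.
case: (eqVneq g.[0] 0) => [/eqP gz|gz]; last by exists g, P'.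
have /factor_theorem[g' gE] : root g 0 by [].
rewrite subr0 in gE.
have g'0 : g' != 0 by apply: contraNneq g0 => g'0; rewrite gE g'0 mul0r.
have sg : (size g' <= n)%N.
  by move: hg; rewrite gE size_mulX.
pose z : {poly {poly F}} -> {poly F} := map_poly (horner_eval 0).
have zZ (c : {poly {poly F}}) r : map_poly z (c *: r) = z c *: map_poly z r.
  exact: map_polyZ.
have zg : z g%:P = 0 by rewrite /z map_polyC /= horner_evalE (eqP gz).
have : z (lead_coef p) *: map_poly z P' == 0 by rewrite -zZ -eg zZ zg scale0r.
rewrite -mul_polyC mulf_eq0 polyC_eq0 (negPf d0) /= => /eqP P'0.
have [P'' PE] : exists P'', P' = 'X%:P *: P''.
  have h (s : {poly F}) : s.[0] = 0 -> s = 'X * (s %/ 'X).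
    move=> s0; rewrite mulrC divpK //.
    by rewrite -['X]subr0 -polyC0 dvdp_XsubCl /root s0.
  exists (map_poly (map_poly (fun s : {poly F} => s %/ 'X)) P').
  apply/polyP=> j; apply/polyP=> l; rewrite coefZ coefCM !coef_map_id0 ?div0p ?map_poly0 //.
  apply: h.
  by have := congr1 (fun s : {poly {poly F}} => s`_j`_l) P'0; rewrite !coef_map /= !coef0.
apply: (IH g' sg g'0 P'').
apply: (@polyZI _ 'X%:P); first by rewrite polyC_eq0 polyX_eq0.
by rewrite !scalerA mulrC -polyCM -gE eg PE scalerA mulrC.
Qed.

(** * Matrices indexed by monomials *)

Lemma coefM_top (R : nzRingType) (p q : {poly R}) a b :
  (size p <= a.+1)%N -> (size q <= b.+1)%N -> (p * q)`_(a + b) = p`_a * q`_b.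
Proof.
move=> hp hq; have la : (a < (a + b).+1)%N by lia.
rewrite coefM (bigD1 (Ordinal la)) //= addKn big1 ?addr0 // => -[i hi] /= ni.
have {}ni : i != a by apply: contraNneq ni => e; apply/eqP/val_inj.
have [ia|ai] := ltnP i a.
  by rewrite [q`__]nth_default ?mulr0 // (leq_trans hq) // ltn_subRL ltn_add2r.
rewrite [p`__]nth_default ?mul0r // (leq_trans hp) //.
by rewrite ltn_neqAle eq_sym ni.
Qed.

Lemma size_prod_top (R : comNzRingType) (I : Type) (s : seq I) (f : I -> {poly R})
    (r : I -> nat) : (forall i, (size (f i) <= (r i).+1)%N) ->
  (size (\prod_(i <- s) f i)%R <= (\sum_(i <- s) r i).+1)%N /\
  (\prod_(i <- s) f i)`_(\sum_(i <- s) r i)%N = \prod_(i <- s) (f i)`_(r i).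
Proof.
move=> h; elim: s => [|i s [IH1 IH2]]; first by rewrite !big_nil size_poly1 coef1.
rewrite !big_cons; split; last by rewrite coefM_top // IH2.
apply: leq_trans (size_polyMleq _ _) _; move: (h i) IH1; move: (size (f i)) (size (\prod_(j <- s) f j)) => u v; lia.
Qed.

Lemma size_det_top (R : comNzRingType) k (A : 'M[{poly R}]_k) (r : 'I_k -> nat) :
  (forall i j, (size (A i j) <= (r i).+1)%N) ->
  (size (\det A) <= (\sum_i r i).+1)%N /\
  (\det A)`_(\sum_i r i)%N = \det (\matrix_(i, j) (A i j)`_(r i)).
Proof.
move=> h; have hs (s : 'S_k) := size_prod_top (index_enum 'I_k) (fun i => h i (s i)).
have sgn (b : bool) (p : {poly R}) : (-1) ^+ b * p = (-1) ^+ b *: p.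
  by case: b; rewrite ?expr1 ?mulN1r ?scaleN1r // expr0 mul1r scale1r.
rewrite /determinant; split.
  apply: leq_trans (size_sum _ _ _) _; apply/bigmax_leqP => s _.
  by rewrite sgn; apply: leq_trans (size_scale_leq _ _) (hs s).1.
rewrite coef_sum; apply: eq_bigr => s _.
rewrite sgn coefZ (hs s).2; congr (_ * _).
by apply: eq_bigr => i _; rewrite mxE.
Qed.

Lemma det_eq0_kernel (D : idomainType) k (A : 'M[D]_k) (v : 'I_k -> D) i0 :
  v i0 != 0 -> (forall i, \sum_j A i j * v j = 0) -> \det A = 0.
Proof.
move=> v0 h; apply/eqP; rewrite -det_tr; apply/det0P; exists (\row_j v j).
  by apply: contraNneq v0 => /rowP/(_ i0); rewrite !mxE => ->.
apply/rowP=> i; rewrite !mxE -[RHS](h i).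
by apply: eq_bigr => j _; rewrite !mxE mulrC.
Qed.

Lemma kernel_of_det_eq0 (D : idomainType) k (A : 'M[D]_k) :
  \det A = 0 -> exists2 v : 'I_k -> D, (exists i, v i != 0) &
    forall i, \sum_j A i j * v j = 0.
Proof.
move=> /eqP; rewrite -det_tr => /det0P[v v0 hv]; exists (v 0).
  apply: contrapT => h; case/negP: v0; apply/eqP/rowP=> i; rewrite mxE.
  by apply: contrapT => hi; apply: h; exists i; apply/eqP.
move=> i; have /rowP/(_ i) := hv; rewrite !mxE => h; rewrite -[RHS]h.
by apply: eq_bigr => j _; rewrite !mxE mulrC.
Qed.

Section FinMatrix.
Variable T : finType.

(** Lets monomials index rows and columns, while [\det] and [char_poly] remain applicable. *)
Definition fmx (Z : Type) (f : T -> T -> Z) : 'M_#|T| :=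
  \matrix_(i, j) f (enum_val i) (enum_val j).

Lemma fmxE Z (f : T -> T -> Z) i j : fmx f i j = f (enum_val i) (enum_val j).
Proof. by rewrite mxE. Qed.

Lemma map_fmx Z Z' (g : Z -> Z') (f : T -> T -> Z) :
  map_mx g (fmx f) = fmx (fun a b => g (f a b)).
Proof. by apply/matrixP=> i j; rewrite !mxE. Qed.

Lemma eq_fmx Z (f g : T -> T -> Z) : f =2 g -> fmx f = fmx g.
Proof. by move=> h; apply/matrixP=> i j; rewrite !mxE. Qed.

Lemma sum_fmx (Z : nmodType) (f : T -> Z) :
  \sum_(i < #|T|) f (enum_val i) = \sum_a f a.
Proof. by rewrite -(big_enum_val (A := T) f); apply: eq_bigl => a; rewrite inE. Qed.

Lemma fmxM (Z : pzSemiRingType) (f g : T -> T -> Z) :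
  fmx f *m fmx g = fmx (fun a b => \sum_c f a c * g c b).
Proof.
apply/matrixP=> i j; rewrite !mxE -sum_fmx.
by apply: eq_bigr => l _; rewrite !mxE.
Qed.

Lemma fmx1 (Z : pzSemiRingType) (c : Z) : c%:M = fmx (fun a b => c *+ (a == b)).
Proof.
by apply/matrixP=> i j; rewrite !mxE (inj_eq enum_val_inj).
Qed.

Lemma det_fmx_eq0P (D : idomainType) (f : T -> T -> D) :
  \det (fmx f) = 0 -> exists2 v : T -> D, (exists a, v a != 0) &
    forall a, \sum_b f a b * v b = 0.
Proof.
move/kernel_of_det_eq0=> [v [i vi] hv]; exists (v \o enum_rank).
  by exists (enum_val i); rewrite /= enum_valK.
move=> a; rewrite -sum_fmx -[RHS](hv (enum_rank a)).
by apply: eq_bigr => j _; rewrite /= enum_valK fmxE enum_rankK.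
Qed.

Lemma det_fmx_eq0 (D : idomainType) (f : T -> T -> D) (v : T -> D) a0 :
  v a0 != 0 -> (forall a, \sum_b f a b * v b = 0) -> \det (fmx f) = 0.
Proof.
move=> v0 h; apply: (@det_eq0_kernel _ _ _ (v \o enum_val) (enum_rank a0)).
  by rewrite /= enum_rankK.
move=> i; rewrite -[RHS](h (enum_val i)) -sum_fmx.
by apply: eq_bigr => j _; rewrite fmxE.
Qed.

End FinMatrix.

Section Monomials.
Variable N : nat.

(** Carved out of the multinomials of bounded degree, which form a finite type, so that it can index
    matrices. *)
Definition mon e : predArgType := {m : 'X_{1..N < e.+1} | mdeg m == e}.
HB.instance Definition _ e := Finite.on (mon e).
HB.instance Definition _ e := SubType.on (mon e).
Definition mval e (a : mon e) : 'X_{1..N} := val (val a).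

Lemma mdeg_mval e (a : mon e) : mdeg (mval a) = e.
Proof. by apply/eqP; case: a. Qed.

Lemma mval_inj e : injective (@mval e).
Proof. by move=> a b h; apply/val_inj/val_inj. Qed.

Lemma mvalP e (m : 'X_{1..N}) : mdeg m = e -> exists a : mon e, mval a = m.
Proof.
move=> h; have lt : (mdeg m < e.+1)%N by rewrite h.
have eq : mdeg (BMultinom lt) == e by rewrite /= h.
by exists (Sub (BMultinom lt) eq).
Qed.

Lemma homog_expand (Z : nzRingType) e (f : {mpoly Z[N]}) :
  f \is e.-homog -> f = \sum_(a : mon e) f@_(mval a) *: 'X_[mval a].
Proof.
move=> hf; apply/mpolyP=> m; rewrite raddf_sum /=.
under eq_bigr do rewrite mcoeffZ mcoeffX.
have [hm|hm] := eqVneq (mdeg m) e.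
  have [a <-] := mvalP hm; rewrite (bigD1 a) //= eqxx mulr1 big1 ?addr0 // => b ba.
  by rewrite (inj_eq (@mval_inj _)) (negPf ba) mulr0.
rewrite big1 => [|a _]; first exact: dhomog_nemf_coeff hf hm.
case: eqP => [e'|]; rewrite ?mulr0 //.
by case/eqP: hm; rewrite -e' mdeg_mval.
Qed.

End Monomials.

(** * The matrices attached to a family of forms *)

Section Forms.
Variables n d : nat.
Hypothesis d_gt0 : (0 < d)%N.
Local Notation N := n.+1.

(** The least degree at which the pigeonhole principle forces an exponent at least [d]. *)
Definition crit := (N * d.-1).+1.
Local Notation T := (mon N crit).

Definition upow (i : 'I_N) : 'X_{1..N} := (U_(i) *+ d)%MM.

(** The default of [fst_ge] is never reached in degree [crit] ([fst_geP]), nor that of [snd_ge] on a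
    nonreduced monomial ([snd_geP]). *)
Definition fst_ge (m : 'X_{1..N}) : 'I_N := odflt ord0 [pick i | (d <= m i)%N].
Definition snd_ge (m : 'X_{1..N}) : 'I_N :=
  odflt ord0 [pick i | (i != fst_ge m) && (d <= m i)%N].
Definition reduced (m : 'X_{1..N}) : bool :=
  [forall i, (i != fst_ge m) ==> (m i < d)%N].

Lemma upowE i j : upow i j = if i == j then d else 0%N.
Proof. by rewrite mulmnE mnm1E; case: eqP; rewrite ?mul1n ?mul0n. Qed.

Lemma upow_le i (m : 'X_{1..N}) : (upow i <= m)%MM = (d <= m i)%N.
Proof.
apply/mnm_lepP/idP=> [/(_ i)|h j]; rewrite upowE ?eqxx //.
by case: eqP => // <-.
Qed.

Lemma mdeg_upow i : mdeg (upow i) = d.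
Proof. by rewrite mdegMn mdeg1 mul1n. Qed.

Lemma fst_geP (m : 'X_{1..N}) : mdeg m = crit -> (d <= m (fst_ge m))%N.
Proof.
rewrite /fst_ge; case: pickP => //= h hm.
have : (mdeg m <= N * d.-1)%N.
  rewrite mdegE; apply: leq_trans (leq_sum _ (fun i _ => (_ : (m i <= d.-1)%N))) _.
    by move=> i; have := h i; lia.
  by rewrite sum_nat_const card_ord.
by rewrite hm ltnn.
Qed.

Lemma snd_geP (m : 'X_{1..N}) : ~~ reduced m ->
  snd_ge m != fst_ge m /\ (d <= m (snd_ge m))%N.
Proof.
rewrite /snd_ge; case: pickP => [i /andP[//]|h] /forallPn[i].
by rewrite negb_imply -leqNgt h.
Qed.

Lemma monomial_split (m : 'X_{1..N}) : mdeg m = crit -> ~~ reduced m ->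
  let p := fst_ge m in let q := snd_ge m in
  (m - upow p - upow q + upow p + upow q)%MM = m.
Proof.
move=> hm /snd_geP[qp hq] /=; have hp := fst_geP hm.
apply/mnmP=> i; rewrite !(mnmDE, mnmBE) !upowE.
case: eqP => [<-|_]; first by rewrite (negPf qp) subn0 addn0 subnK.
rewrite subn0 addn0; case: eqP => [<-|_]; first by rewrite subnK.
by rewrite subn0 addn0.
Qed.

Section Ring.
Variable Z : comNzRingType.
Implicit Types F : 'I_N -> {mpoly Z[N]}.

Lemma mpolyX_upow i : 'X_i ^+ d = 'X_[upow i] :> {mpoly Z[N]}.
Proof. by rewrite -mpolyXn. Qed.

Definition minor F p q : {mpoly Z[N]} := 'X_p ^+ d * F q - 'X_q ^+ d * F p.
Definition lift_row F (m : 'X_{1..N}) : {mpoly Z[N]} :=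
  'X_[m - upow (fst_ge m)] * F (fst_ge m).
(** One multiple of a minor for each nonreduced [m]. For [F_i = i x_i^d] it is [(q - p) x^m], where
    [p = fst_ge m] and [q = snd_ge m]. *)
Definition syz F (m : 'X_{1..N}) : {mpoly Z[N]} :=
  'X_[m - upow (fst_ge m) - upow (snd_ge m)] * minor F (fst_ge m) (snd_ge m).

Definition Tmx F : 'M[Z]_#|T| := fmx (fun a b : T =>
  if reduced (mval a) then (a == b)%:R else (syz F (mval a))@_(mval b)).
Definition Nmx F : 'M[{poly Z}]_#|T| := fmx (fun a b : T =>
  if reduced (mval a) then (a == b)%:R *: 'X - ((lift_row F (mval a))@_(mval b))%:P
  else ((syz F (mval a))@_(mval b))%:P).
Definition Cmx F : 'M[Z]_#|T| :=
  fmx (fun a b : T => (lift_row F (mval a))@_(mval b)).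

Definition rank_red := #|[pred a : T | reduced (mval a)]|.

(** The reduced rows of [Nmx] have degree at most 1 in ['X], the others degree 0, and [Tmx] collects
    the coefficients of the rows at these degrees. *)
Lemma size_det_Nmx F : (size (\det (Nmx F)) <= rank_red.+1)%N /\
  (\det (Nmx F))`_rank_red = \det (Tmx F).
Proof.
pose r (i : 'I_#|T|) : nat := reduced (mval (enum_val i)).
have [|h1 h2] := @size_det_top _ _ (Nmx F) r.
  move=> i j; rewrite fmxE /r; case: ifP => _; last exact: size_polyC_leq1.
  apply: leq_trans (size_polyD _ _) _; rewrite size_polyN geq_max.
  rewrite (leq_trans (size_scale_leq _ _)) ?size_polyX //=.
  exact: leq_trans (size_polyC_leq1 _) _.
have e : (\sum_i r i)%N = rank_red.
  by rewrite /r (sum_fmx (fun a : T => (reduced (mval a) : nat))) /rank_red -sum1_card [RHS]big_mkcond;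
    apply: eq_bigr => a _; rewrite inE; case: reduced.
rewrite e in h1 h2; split=> //; rewrite h2; congr (\det _).
apply/matrixP=> i j; rewrite !mxE /r; case: ifP => _; last by rewrite coefC.
by rewrite coefB coefZ coefX coefC mulr1 subr0.
Qed.

Lemma lift_row_homog F (m : 'X_{1..N}) : (forall i, F i \is d.-homog) ->
  mdeg m = crit -> lift_row F m \is crit.-homog.
Proof.
move=> hF hm; have hp := fst_geP hm; rewrite -upow_le in hp.
have -> : crit = (mdeg (m - upow (fst_ge m))%MM + d)%N.
  by rewrite -(mdeg_upow (fst_ge m)) -mdegD submK.
by apply: dhomogM => //; rewrite dhomogX.
Qed.

Lemma minor_homog F p q e : (forall i, F i \is d.-homog) -> e = (d + d)%N ->
  minor F p q \is e.-homog.
Proof.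
move=> hF ->; have hX i : 'X_i ^+ d \is [in Z[N], d.-homog].
  by rewrite mpolyX_upow dhomogX /= mdeg_upow.
by rewrite rpredB // dhomogM.
Qed.

Lemma syz_homog F (m : 'X_{1..N}) : (forall i, F i \is d.-homog) ->
  mdeg m = crit -> ~~ reduced m -> syz F m \is crit.-homog.
Proof.
move=> hF hm nr; rewrite /syz; set g := (m - _ - _)%MM.
have -> : crit = (mdeg g + (d + d))%N.
  by rewrite -{1}hm -{1}(monomial_split hm nr) !mdegD !mdeg_upow addnA.
apply: dhomogM; first by rewrite dhomogX.
exact: minor_homog.
Qed.

End Ring.

Section Morphism.
Variables (Z Z' : comNzRingType) (phi : {rmorphism Z -> Z'}).
Implicit Types F : 'I_N -> {mpoly Z[N]}.
Local Notation "F ^f" := (fun i => map_mpoly phi (F i)).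

Lemma map_lift_row F m : map_mpoly phi (lift_row F m) = lift_row F^f m.
Proof. by rewrite rmorphM /= map_mpolyX. Qed.

Lemma map_minor F p q : map_mpoly phi (minor F p q) = minor F^f p q.
Proof. by rewrite rmorphB !rmorphM /= !rmorphXn /= !map_mpolyX. Qed.

Lemma map_syz F m : map_mpoly phi (syz F m) = syz F^f m.
Proof. by rewrite rmorphM /= map_mpolyX map_minor. Qed.

Lemma map_Tmx F : map_mx phi (Tmx F) = Tmx F^f.
Proof.
rewrite map_fmx; apply: eq_fmx => a b.
by case: ifP => _; rewrite ?rmorph_nat // -map_syz mcoeff_map_mpoly.
Qed.

Lemma map_Nmx F : map_mx (map_poly phi) (Nmx F) = Nmx F^f.
Proof.
rewrite map_fmx; apply: eq_fmx => a b; case: ifP => _.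
  by rewrite rmorphB /= map_polyZ map_polyX map_polyC rmorph_nat -map_lift_row mcoeff_map_mpoly.
by rewrite map_polyC -map_syz mcoeff_map_mpoly.
Qed.

Lemma map_det_Tmx F : phi (\det (Tmx F)) = \det (Tmx F^f).
Proof. by rewrite -map_Tmx det_map_mx. Qed.

Lemma map_det_Nmx F : map_poly phi (\det (Nmx F)) = \det (Nmx F^f).
Proof. by rewrite -map_Nmx det_map_mx. Qed.

End Morphism.

Section Eigenpair.
Variables (Z : idomainType) (F : 'I_N -> {mpoly Z[N]}) (lam : Z) (x : 'I_N -> Z).
Hypotheses (hF : forall i, F i \is d.-homog) (x_neq0 : forall i, x i != 0).
Hypothesis eigen : forall i, (F i).@[x] = lam * x i ^+ d.

Lemma minor_eigen p q : (minor F p q).@[x] = 0.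
Proof. by rewrite mevalB !mevalM !rmorphXn /= !mevalXU !eigen; ring. Qed.

Lemma lift_row_eigen m : mdeg m = crit ->
  (lift_row F m).@[x] = lam * ('X_[m] : {mpoly Z[N]}).@[x].
Proof.
move=> hm; have hp := fst_geP hm; rewrite -upow_le in hp.
rewrite -{2}(submK hp) mpolyXD -mpolyX_upow !mevalM rmorphXn /= mevalXU eigen.
by rewrite mulrCA.
Qed.

Lemma homog_meval e (f : {mpoly Z[N]}) : f \is e.-homog ->
  \sum_(b : mon N e) f@_(mval b) * ('X_[mval b] : {mpoly Z[N]}).@[x] = f.@[x].
Proof.
move=> hf; rewrite {2}(homog_expand hf) raddf_sum /=.
by apply: eq_bigr => b _; rewrite mevalZ.
Qed.

(** The values at [x] of the monomials of degree [crit] form a kernel vector of [Nmx] at [lam]: the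
    reduced rows vanish on it by the eigenvalue equation, the others because the minors vanish at
    [x]. *)
Lemma det_Nmx_root : root (\det (Nmx F)) lam.
Proof.
apply/eqP; rewrite -[LHS](det_map_mx (horner_eval lam)) map_fmx.
have [a0 _] : exists a0 : T, mval a0 = (U_(ord0) *+ crit)%MM.
  by apply: mvalP; rewrite mdegMn mdeg1 mul1n.
apply: (det_fmx_eq0 (v := fun b => ('X_[mval b] : {mpoly Z[N]}).@[x]) (a0 := a0)).
  by rewrite mevalX; apply/prodf_neq0 => i _; rewrite expf_neq0.
move=> a; have hm := mdeg_mval a; cbv beta.
case: (boolP (reduced (mval a))) => [ra|nra].
  under eq_bigr do
    rewrite /= horner_evalE hornerD hornerN hornerZ hornerX hornerC mulrBl.
  rewrite sumrB (homog_meval (lift_row_homog hF hm)) lift_row_eigen //.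
  rewrite (bigD1 a) //= eqxx mul1r big1 ?addr0 ?subrr // => b ba.
  by rewrite eq_sym (negPf ba) !mul0r.
under eq_bigr do rewrite /= horner_evalE hornerC.
by rewrite (homog_meval (syz_homog hF hm nra)) mevalM minor_eigen mulr0.
Qed.

End Eigenpair.

Section SplitForms.
Variable R : numFieldType.

(* For [r_i = (x_i / x_0)^d] these forms have the eigenpair [(lam, x)]. *)
Definition split_form (lam : R) (r : 'I_N -> R) (i : 'I_N) : {mpoly R[N]} :=
  lam *: 'X_i ^+ d + i%:R *: ('X_i ^+ d - r i *: 'X_ord0 ^+ d).

Lemma split_form_homog lam r i : split_form lam r i \is d.-homog.
Proof.
have hX j : 'X_j ^+ d \is [in R[N], d.-homog].
  by rewrite mpolyX_upow dhomogX /= mdeg_upow.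
by rewrite rpredD ?rpredZ // rpredB ?rpredZ.
Qed.

Lemma minor_split_form lam r p q : minor (split_form lam r) p q =
  (q%:R - p%:R) *: 'X_[upow p + upow q]
  - (q%:R * r q) *: 'X_[upow p + upow ord0]
  + (p%:R * r p) *: 'X_[upow q + upow ord0].
Proof.
rewrite /minor /split_form !mpolyX_upow -!mul_mpolyC !mpolyXD.
rewrite !(mpolyCB, mpolyCM); ring.
Qed.

(** The matrix is triangular with respect to the exponent of [x_0]. A nonreduced row has diagonal
    coefficient [q - p], nonzero in characteristic 0, and its other terms trade [x_p^d] or [x_q^d]
    for [x_0^d], with a coefficient that vanishes if the traded index is 0. *)
Lemma det_Tmx_split_form lam r : \det (Tmx (split_form lam r)) != 0.
Proof.
apply/eqP=> /det_fmx_eq0P[y [a0 ya0] hy].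
(* Extends [y] by 0 to the monomials of other degrees. *)
pose y' (m : 'X_{1..N}) := \sum_(b : T) (m == mval b)%:R * y b.
have y'E (a : T) : y' (mval a) = y a.
  rewrite /y' (bigD1 a) //= eqxx mul1r big1 ?addr0 // => b ba.
  by rewrite (inj_eq (@mval_inj _ _)) eq_sym (negPf ba) mul0r.
(* Downward induction on the exponent of [x_0], which never exceeds [crit]. *)
suff h k (a : T) : (crit < k + mval a ord0)%N -> y a = 0.
  by case/eqP: ya0; apply: (h crit.+1); lia.
elim: k a => [|k IH] a hk.
  move: hk; rewrite add0n -{1}(mdeg_mval a) mdegE (bigD1 ord0) //=; lia.
have := hy a; cbv beta; case: (boolP (reduced (mval a))) => [_|nra].
  rewrite (bigD1 a) //= eqxx mul1r big1 ?addr0 // => b ba.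
  by rewrite eq_sym (negPf ba) mul0r.
have hm := mdeg_mval a; have [qp hq] := snd_geP nra.
have /= sp := monomial_split hm nra.
rewrite /syz; set p := fst_ge _ in qp sp *; set q := snd_ge _ in qp hq sp *.
set g := (mval a - upow p - upow q)%MM in sp *.
have z (m : 'X_{1..N}) : (mval a ord0 < m ord0)%N -> y' m = 0.
  move=> hlt; rewrite /y' big1 // => b _; case: eqP => [e|]; rewrite ?mul0r // mul1r.
  by apply: IH; rewrite -e; lia.
rewrite minor_split_form.
have zc (i j : 'I_N) : mval a = (g + upow i + upow j)%MM ->
    i%:R * r i * y' (g + upow j + upow ord0)%MM = 0.
  move=> e; have [i0|i0] := eqVneq i ord0; first by rewrite i0 !mul0r.
  rewrite z ?mulr0 // e !mnmDE !upowE eqxx (negPf i0); lia.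
have c1 : mval a = (g + upow q + upow p)%MM by rewrite -sp -!addmA [(upow p + _)%MM]addmC.
move: (zc q p c1) (zc p q (esym sp)); set c := _ - p%:R.
have : c = 0 -> y a = 0.
  move=> /eqP; rewrite subr_eq0 eqr_nat => /eqP qp'.
  by case/eqP: qp; apply: val_inj.
move: c (q%:R * r q) (p%:R * r p) => c cp cq hc zp zq.
rewrite !mulrDr mulrN -!scalerAr -!mpolyXD !addmA sp.
under eq_bigr do rewrite mcoeffD mcoeffB !mcoeffZ !mcoeffX !mulrDl !mulNr -!mulrA.
have fold m : \sum_b (m == mval b)%:R * y b = y' m by [].
rewrite big_split /= sumrB -!mulr_sumr !fold y'E.
by rewrite zp zq subr0 addr0 => /eqP; rewrite mulf_eq0 => /orP[/eqP/hc|/eqP].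
Qed.

End SplitForms.
End Forms.

(** * Relations between the minors *)

Section Relations.
Variables n d : nat.
Hypothesis d_gt0 : (0 < d)%N.
Local Notation N := n.+1.
Local Notation deg2 := (crit n d - (d + d))%N.
(** Indexes the products [x^g * minor p q] over all ordered pairs, [p = q] included. If [crit < 2d],
    the degree of [g] truncates to 0; the hypothesis of [minor_syz_span] excludes that case. *)
Local Notation E := ('I_N * 'I_N * mon N deg2)%type.
Local Notation upow := (upow d).

Lemma nonreduced (m : 'X_{1..N}) (p q : 'I_N) :
  p != q -> (d <= m p)%N -> (d <= m q)%N ->
  [/\ fst_ge d m != snd_ge d m, (d <= m (fst_ge d m))%N, (d <= m (snd_ge d m))%N
    & ~~ reduced d m].
Proof.
move=> pq hp hq.
have nr : ~~ reduced d m.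
  have [e|ne] := eqVneq p (fst_ge d m); apply/forallPn.
    by exists q; rewrite -e eq_sym pq -leqNgt.
  by exists p; rewrite ne -leqNgt.
have [sf hs] := snd_geP nr; split=> //; first by rewrite eq_sym.
by rewrite /fst_ge; case: pickP => //= /(_ p); rewrite hp.
Qed.

Definition third (p q : 'I_N) (m : 'X_{1..N}) : 'I_N :=
  if (fst_ge d m != p) && (fst_ge d m != q) then fst_ge d m else snd_ge d m.

(** If [fst_ge] and [snd_ge] both lay in [{p, q}], they would be [p] and [q] in one of the two
    excluded orders. *)
Lemma thirdP (p q : 'I_N) (m : 'X_{1..N}) :
  p != q -> (d <= m p)%N -> (d <= m q)%N ->
  (p, q) != (fst_ge d m, snd_ge d m) -> (q, p) != (fst_ge d m, snd_ge d m) ->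
  let i := third p q m in
  [/\ i != p, i != q, (d <= m i)%N & i \in [:: fst_ge d m; snd_ge d m]].
Proof.
move=> pq hp hq h1 h2; have [fs hf hs _] := nonreduced pq hp hq.
rewrite /third; case: ifP => [/andP[fp fq]|hF]; first by rewrite /= !inE eqxx.
rewrite !inE eqxx orbT /=; split=> //; apply: contraFN hF => /eqP e.
- by move: h2; rewrite -e xpair_eqE eqxx andbT fs eq_sym.
- by move: h1; rewrite -e xpair_eqE eqxx andbT fs andbT eq_sym.
Qed.

Section Ring.
Variable Z : comNzRingType.
Implicit Types (F : 'I_N -> {mpoly Z[N]}) (e : E).

Definition top_mon e : 'X_{1..N} := (mval e.2 + upow e.1.1 + upow e.1.2)%MM.

(* The coefficient of the generator [x^g * minor p' q'] in the Eagon-Northcott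
   type relation attached to [e]: with [i] a third index, the combination
   [q * (x_i^d m_pq + x_p^d m_qi + x_q^d m_ip) - (F_i m_pq + F_p m_qi + F_q m_ip)]
   of two vanishing expressions.  At [F_i = i x_i^d] it involves two generators only. *)
Definition minor_rel F e (p' q' : 'I_N) : {mpoly Z[N]} :=
  let: (p, q, g) := e in
  let pq := ((p', q') == (p, q))%:R in
  if (p == q) || ((p, q) == (fst_ge d (top_mon e), snd_ge d (top_mon e))) then pq * 'X_[mval g]
  else if (q, p) == (fst_ge d (top_mon e), snd_ge d (top_mon e)) then
    (pq + ((p', q') == (q, p))%:R) * 'X_[mval g]
  else let i := third p q (top_mon e) in
    'X_[mval g - upow i] * (pq * (q%:R * 'X_i ^+ d - F i)
       + ((p', q') == (q, i))%:R * (q%:R * 'X_p ^+ d - F p)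
       + ((p', q') == (i, p))%:R * (q%:R * 'X_q ^+ d - F q)).

Definition Emx F : 'M[Z]_#|{: E}| :=
  fmx (fun e e' : E => (minor_rel F e e'.1.1 e'.1.2)@_(mval e'.2)).

Lemma top_le e : e.1.1 != e.1.2 -> (d <= top_mon e e.1.1)%N /\ (d <= top_mon e e.1.2)%N.
Proof.
move=> pq; rewrite /top_mon !mnmDE !upowE !eqxx (negPf pq) eq_sym (negPf pq).
by rewrite addn0 leq_addl leq_addl.
Qed.

Lemma third_top e : e.1.1 != e.1.2 ->
  e.1 != (fst_ge d (top_mon e), snd_ge d (top_mon e)) ->
  (e.1.2, e.1.1) != (fst_ge d (top_mon e), snd_ge d (top_mon e)) ->
  let i := third e.1.1 e.1.2 (top_mon e) in
  [/\ i != e.1.1, i != e.1.2, (upow i <= mval e.2)%MM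
    & i \in [:: fst_ge d (top_mon e); snd_ge d (top_mon e)]].
Proof.
case: e => [[p q] g] pq h1 h2; have [hp hq] := top_le pq.
have [/= ip iq hi hin] := thirdP pq hp hq h1 h2; split=> //.
rewrite upow_le; move: hi; rewrite {2}/top_mon /= !mnmDE !upowE.
by rewrite eq_sym (negPf ip) eq_sym (negPf iq) !addn0.
Qed.

Lemma minor_rel_homog F e p' q' : (forall i, F i \is d.-homog) ->
  minor_rel F e p' q' \is deg2.-homog.
Proof.
move=> hF; case: e => [[p q] g].
have hX i : 'X_i ^+ d \is [in Z[N], d.-homog].
  by rewrite mpolyX_upow dhomogX /= mdeg_upow.
have hg : 'X_[mval g] \is [in Z[N], deg2.-homog].
  by rewrite dhomogX /= mdeg_mval.
have nat0 (k e : nat) (f : {mpoly Z[N]}) : f \is e.-homog -> k%:R * f \is e.-homog.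
  by move=> hf; rewrite mulr_natl rpredMn.
rewrite /minor_rel; case: ifP => [_|/norP[pq h1]]; first exact: nat0.
case: ifP => [_|/negbT h2]; first by rewrite -natrD nat0.
have [_ _ hi _] := third_top (e := (p, q, g)) pq h1 h2.
set i := third _ _ _ in hi *.
have eg : (mdeg (mval g - upow i)%MM + d)%N = deg2.
  have := congr1 mdeg (submK hi); rewrite mdegD mdeg_upow => ->.
  exact: mdeg_mval.
apply: (eq_ind _ (fun k => _ \is k.-homog) _ _ eg).
apply: dhomogM; first by rewrite dhomogX.
by rewrite !rpredD // nat0 // rpredB // nat0.
Qed.

Lemma minorpp F p : minor d F p p = 0. Proof. exact: subrr. Qed.

Lemma minor_anti F p q : minor d F p q + minor d F q p = 0.
Proof. by rewrite /minor; ring. Qed.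

Lemma sum_indicator (f : 'I_N -> 'I_N -> {mpoly Z[N]}) (a b : 'I_N) (c : {mpoly Z[N]}) :
  \sum_(x : 'I_N * 'I_N) ((x.1, x.2) == (a, b))%:R * c * f x.1 x.2 = c * f a b.
Proof.
rewrite (bigD1 (a, b)) //= eqxx mul1r big1 ?addr0 // => -[x y] /= /negPf ->.
by rewrite !mul0r.
Qed.

(** A relation gives 0 by [m_pp = 0], by antisymmetry, or, with a third index, because both
    expressions are determinants of order 3 with a repeated row. Only the rows at [(fst_ge, snd_ge)]
    survive. *)
Lemma Emx_minor F e : (forall i, F i \is d.-homog) ->
  \sum_(e' : E) (minor_rel F e e'.1.1 e'.1.2)@_(mval e'.2)
     *: ('X_[mval e'.2] * minor d F e'.1.1 e'.1.2) =
  if e.1 == (fst_ge d (top_mon e), snd_ge d (top_mon e))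
  then 'X_[mval e.2] * minor d F e.1.1 e.1.2 else 0.
Proof.
move=> hF; transitivity (\sum_(x : 'I_N * 'I_N) minor_rel F e x.1 x.2 * minor d F x.1 x.2).
  rewrite -(pair_bigA _ (fun (x : 'I_N * 'I_N) g => (minor_rel F e x.1 x.2)@_(mval g)
     *: ('X_[mval g] * minor d F x.1 x.2))) /=.
  apply: eq_bigr => x _; rewrite {2}(homog_expand (minor_rel_homog e x.1 x.2 hF)) mulr_suml.
  by apply: eq_bigr => g _; rewrite scalerAl.
case: e => [[p q] g]; rewrite /minor_rel /=; set t := top_mon _.
have [h1|h1] := boolP ((p, q) == (fst_ge d t, snd_ge d t)).
  by rewrite orbT; apply: sum_indicator.
have [pq|pq] := eqVneq p q.
  by rewrite [LHS]sum_indicator pq minorpp mulr0.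
have [h2|h2] /= := boolP ((q, p) == (fst_ge d t, snd_ge d t)).
  under eq_bigr do rewrite !mulrDl.
  by rewrite big_split /= !sum_indicator -mulrDr minor_anti mulr0.
set i := third _ _ _; set eta := (mval g - _)%MM.
pose A := 'X_[eta] * (q%:R * 'X_i ^+ d - F i).
pose B := 'X_[eta] * (q%:R * 'X_p ^+ d - F p).
pose C := 'X_[eta] * (q%:R * 'X_q ^+ d - F q).
transitivity (\sum_(x : 'I_N * 'I_N) (((x.1, x.2) == (p, q))%:R * A * minor d F x.1 x.2
    + ((x.1, x.2) == (q, i))%:R * B * minor d F x.1 x.2
    + ((x.1, x.2) == (i, p))%:R * C * minor d F x.1 x.2)).
  apply: eq_bigr => x _; rewrite /A /B /C.
  by move: (_ == (p, q))%:R (_ == (q, i))%:R (_ == (i, p))%:R => u v w; ring.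
by rewrite !big_split /= !sum_indicator /A /B /C /minor; ring.
Qed.


Lemma top_swap p q (g : mon N deg2) : top_mon (q, p, g) = top_mon (p, q, g).
Proof. by rewrite /top_mon /= -!addmA [(upow q + _)%MM]addmC. Qed.

End Ring.

Lemma map_Emx (Z Z' : comNzRingType) (phi : {rmorphism Z -> Z'})
    (F : 'I_N -> {mpoly Z[N]}) :
  map_mx phi (Emx F) = Emx (fun i => map_mpoly phi (F i)).
Proof.
rewrite map_fmx; apply: eq_fmx => -[[p q] g] [[p' q'] g'].
rewrite -mcoeff_map_mpoly; congr (_@__); rewrite /minor_rel.
case: ifP => _; first by rewrite rmorphM rmorph_nat /= map_mpolyX.
case: ifP => _; first by rewrite rmorphM rmorphD !rmorph_nat /= map_mpolyX.
rewrite rmorphM /= map_mpolyX; congr (_ * _).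
by rewrite !(rmorphD, rmorphN, rmorphM, rmorph_nat) /= !rmorphXn /= !map_mpolyX.
Qed.

(** Here the row of [(p, q, g)] with third index [i] has entries [q - i] at [(p, q, g)], [q - p] at
    one [(q, i, g')] and nothing at [(i, p)]. So a kernel vector vanishes at [(p, q, g)] once it
    does at [(q, i, g')]; since [i] is [fst_ge] or [snd_ge], at most two such moves reach a row of
    the first two kinds. *)
Lemma det_Emx_split_form (R : numFieldType) :
  \det (Emx (split_form d (0 : R) (fun=> 0))) != 0.
Proof.
set F := split_form _ _ _.
have FE (q j : 'I_N) : q%:R * 'X_j ^+ d - F j = (q%:R - j%:R) *: 'X_[upow j].
  by rewrite /F /split_form !scale0r subr0 add0r mulr_natl -scaler_nat -scalerBl mpolyX_upow.
apply/eqP=> /det_fmx_eq0P[y [e0 ye0] hy].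
pose y' (p q : 'I_N) (m : 'X_{1..N}) : R := \sum_(e : E)
  ((e.1.1, e.1.2) == (p, q))%:R * (m == mval e.2)%:R * y e.
have y'E e : y' e.1.1 e.1.2 (mval e.2) = y e.
  case: e => [[p q] g]; rewrite /y' (bigD1 (p, q, g)) //= !eqxx !mul1r big1 ?addr0 //.
  move=> [[p' q'] g'] /=; rewrite xpair_eqE (inj_eq (@mval_inj _ _)) [g == _]eq_sym.
  by case: (_ == (p, q)) (g' == g) => [] [] //=; rewrite ?mul0r ?mulr0 ?mul0r.
have coefb (b : bool) (f : {mpoly R[N]}) m : (b%:R * f)@_m = b%:R * f@_m.
  by rewrite !mulr_natl mcoeffMn.
have row1 e : (e.1.1 == e.1.2) || (e.1 == (fst_ge d (top_mon e), snd_ge d (top_mon e))) -> y e = 0.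
  move=> h; rewrite -y'E -[RHS](hy e); case: e h => [[p q] g] /= h.
  by apply: eq_bigr => e' _; rewrite /minor_rel h coefb mcoeffX.
have row2 e : e.1.1 != e.1.2 -> e.1 != (fst_ge d (top_mon e), snd_ge d (top_mon e)) ->
    (e.1.2, e.1.1) == (fst_ge d (top_mon e), snd_ge d (top_mon e)) -> y e = 0.
  case: e => [[p q] g] /= pq h1 h2.
  have := row1 (q, p, g); rewrite /= top_swap h2 orbT => /(_ isT) => e2.
  have := hy (p, q, g); rewrite /minor_rel (negPf pq) (negPf h1) h2 /=.
  under eq_bigr do rewrite mulrDl mcoeffD !coefb !mcoeffX mulrDl.
  rewrite big_split /= -/(y' p q (mval g)) -/(y' q p (mval g)).
  by rewrite (y'E (p, q, g)) (y'E (q, p, g)) e2 addr0.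
have row3 e : e.1.1 != e.1.2 -> e.1 != (fst_ge d (top_mon e), snd_ge d (top_mon e)) ->
    (e.1.2, e.1.1) != (fst_ge d (top_mon e), snd_ge d (top_mon e)) ->
    let i := third e.1.1 e.1.2 (top_mon e) in
    exists e', [/\ e'.1 = (e.1.2, i), top_mon e' = top_mon e & y e' = 0 -> y e = 0].
  case: e => [[p q] g] pq h1 h2 i.
  have [/= ip iq hi _] := third_top pq h1 h2; rewrite -/i in ip iq hi.
  (* Trading [x_i^d] for [x_p^d] in [g] keeps [top_mon], and with it [fst_ge] and [snd_ge]. *)
  have dg : mdeg (mval g - upow i + upow p)%MM = deg2.
    have := congr1 mdeg (submK hi); rewrite !mdegD !mdeg_upow => ->; exact: mdeg_mval.
  have [g' g'E] := mvalP dg; exists (q, i, g'); split=> //.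
    rewrite /top_mon /= g'E -{2}(submK hi) -!addmA; congr (_ + _)%MM.
    by rewrite [RHS]addmC -addmA.
  move=> y0; have := hy (p, q, g); rewrite /minor_rel (negPf pq) (negPf h1) (negPf h2) /= -/i.
  under eq_bigr do rewrite !FE subrr scale0r mulr0 addr0 mulrDr mcoeffD mulrDl
    !['X_[_] * (_ * _)]mulrCA !coefb -!scalerAr -!mpolyXD !mcoeffZ !mcoeffX submK //
    ![_%:R * (_ * _)]mulrCA -!mulrA.
  rewrite big_split /= -!mulr_sumr.
  under eq_bigr do rewrite mulrA.
  rewrite -/(y' p q (mval g)) (y'E (p, q, g)).
  under eq_bigr do rewrite mulrA -g'E.
  rewrite -/(y' q i (mval g')) (y'E (q, i, g')) y0 mulr0 addr0 => /eqP.
  rewrite mulf_eq0 subr_eq0 eqr_nat => /orP[/eqP qi|/eqP//].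
  by case/eqP: iq; apply: val_inj.
(* From such an [e] a single move leads to a pair made of [fst_ge] and [snd_ge]. *)
have main2 e : e.1.1 != e.1.2 ->
    e.1.2 \in [:: fst_ge d (top_mon e); snd_ge d (top_mon e)] -> y e = 0.
  move=> pq hq.
  have [h1|h1] := boolP (e.1 == (fst_ge d (top_mon e), snd_ge d (top_mon e))).
    by apply: row1; rewrite h1 orbT.
  have [h2|h2] := boolP ((e.1.2, e.1.1) == (fst_ge d (top_mon e), snd_ge d (top_mon e))).
    exact: row2.
  have [ip iq hi hin] := third_top pq h1 h2.
  have [e' [e'1 te' ->]] // := row3 e pq h1 h2.
  have e'ne : e'.1.1 != e'.1.2 by rewrite e'1 /= eq_sym.
  have [h3|h3] := boolP (e'.1 == (fst_ge d (top_mon e'), snd_ge d (top_mon e'))).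
    by apply: row1; rewrite h3 orbT.
  apply: row2 => //; rewrite te' e'1 /=; move: h3; rewrite te' e'1.
  move: hin hq iq; rewrite !inE !xpair_eqE /=.
  by case/orP=> /eqP->; case/orP=> /eqP->; rewrite ?eqxx ?andbT.
case/eqP: ye0; have [pq|pq] := eqVneq e0.1.1 e0.1.2; first by apply: row1; rewrite pq eqxx.
have [h1|h1] := boolP (e0.1 == (fst_ge d (top_mon e0), snd_ge d (top_mon e0))).
  by apply: row1; rewrite h1 orbT.
have [h2|h2] := boolP ((e0.1.2, e0.1.1) == (fst_ge d (top_mon e0), snd_ge d (top_mon e0))).
  exact: row2.
have [ip iq hi hin] := third_top pq h1 h2.
have [e' [e'1 te' ->]] // := row3 e0 pq h1 h2.
by apply: main2; rewrite ?te' e'1 //= eq_sym.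
Qed.

End Relations.

(** * The generic determinant divides a characteristic polynomial *)

Section Field.
Variables n d : nat.
Hypothesis d_gt0 : (0 < d)%N.
Local Notation N := n.+1.
Local Notation deg2 := (crit n d - (d + d))%N.
Local Notation E := ('I_N * 'I_N * mon N deg2)%type.
Local Notation T := (mon N (crit n d)).
Local Notation upow := (upow d).
Variables (Q : fieldType) (F : 'I_N -> {mpoly Q[N]}).
Hypotheses (hF : forall i, F i \is d.-homog) (hE : \det (Emx d F) != 0).

Definition syz_span (f : {mpoly Q[N]}) : Prop := exists h : T -> Q,
  f = \sum_(a : T | ~~ reduced d (mval a)) h a *: syz d F (mval a).

Lemma syz_spanP c f g : syz_span f -> syz_span g -> syz_span (c *: f + g).
Proof.
move=> [h ->] [k ->]; exists (fun a => c * h a + k a).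
rewrite scaler_sumr -big_split; apply: eq_bigr => a _ /=.
by rewrite scalerDl scalerA.
Qed.

Lemma syz_span0 : syz_span 0.
Proof. by exists (fun=> 0); rewrite big1 // => a _; rewrite scale0r. Qed.

Lemma syz_span_sum (I : Type) (s : seq I) (c : I -> Q) f :
  (forall i, syz_span (f i)) -> syz_span (\sum_(i <- s) c i *: f i).
Proof.
move=> hf; elim: s => [|i s IH]; first by rewrite big_nil; apply: syz_span0.
by rewrite big_cons; apply: syz_spanP.
Qed.

Lemma syz_span_syz (a : T) : ~~ reduced d (mval a) -> syz_span (syz d F (mval a)).
Proof.
move=> na; exists (fun b => (b == a)%:R).
rewrite (bigD1 a) //= eqxx scale1r big1 ?addr0 // => b /andP[_ /negPf->].
by rewrite scale0r.
Qed.

(** The inverse of [Emx] writes every such product as a combination of the right-hand sides of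
    [Emx_minor], each of which is 0 or a [syz]. *)
Lemma minor_syz_span (g : 'X_{1..N}) p q : (mdeg g + (d + d))%N = crit n d ->
  syz_span ('X_[g] * minor d F p q).
Proof.
move=> hg; have [g' <-] : exists g' : mon N deg2, mval g' = g by apply: mvalP; lia.
pose D (e : E) := 'X_[mval e.2] * minor d F e.1.1 e.1.2.
have base (e : E) : syz_span (if e.1 == (fst_ge d (top_mon e), snd_ge d (top_mon e))
    then 'X_[mval e.2] * minor d F e.1.1 e.1.2 else 0).
  case: eqP => he; last exact: syz_span0.
  have [pq|pq] := eqVneq e.1.1 e.1.2; first by rewrite pq minorpp mulr0; apply: syz_span0.
  have [hp hq] := top_le pq; have [_ _ _ nr] := nonreduced pq hp hq.
  have [a aE] : exists a : T, mval a = top_mon e.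
    by apply: mvalP; rewrite !mdegD !mdeg_upow mdeg_mval; lia.
  rewrite -aE in nr; have := syz_span_syz nr; rewrite aE /syz.
  have -> : (top_mon e - upow (fst_ge d (top_mon e)) - upow (snd_ge d (top_mon e)))%MM = mval e.2.
    have [<- <-] : e.1.1 = fst_ge d (top_mon e) /\ e.1.2 = snd_ge d (top_mon e).
      by move: he; case: (e.1) => u v [-> ->].
    by rewrite submDA /top_mon -addmA addmK.
  by move: he; case: (e.1) => u v [<- <-].
rewrite -[X in syz_span X]/(D (p, q, g')).
have uM : Emx d F \in unitmx by rewrite unitmxE unitfE.
have -> : D (p, q, g') = \sum_i invmx (Emx d F) (enum_rank (p, q, g')) i *:
    (\sum_j Emx d F i j *: D (enum_val j)).
  under eq_bigr do rewrite scaler_sumr; rewrite exchange_big /=.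
  transitivity (\sum_j (invmx (Emx d F) *m Emx d F) (enum_rank (p, q, g')) j *: D (enum_val j)).
    rewrite (mulVmx uM) (bigD1 (enum_rank (p, q, g'))) //= mxE eqxx scale1r enum_rankK.
    rewrite big1 ?addr0 // => j ji; by rewrite mxE eq_sym (negPf ji) scale0r.
  apply: eq_bigr => j _; rewrite mxE scaler_suml.
  by apply: eq_bigr => i _; rewrite scalerA.
apply: syz_span_sum => i.
have := Emx_minor (enum_val i) hF; set X := (X in X = _); set Y := (Y in _ = Y).
suff -> : \sum_j Emx d F i j *: D (enum_val j) = X by move->; apply: base.
rewrite /X -(sum_fmx (fun e' : E => _)); apply: eq_bigr => j _.
by rewrite fmxE.
Qed.

(** The operator with matrix [Cmx] in degree [crit]; terms of other degrees are sent to 0. *)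
Definition Chat (f : {mpoly Q[N]}) : {mpoly Q[N]} :=
  \sum_(b : T) f@_(mval b) *: lift_row d F (mval b).

Lemma Chat_is_linear : linear Chat.
Proof.
move=> c f g; rewrite /Chat scaler_sumr -big_split; apply: eq_bigr => b _ /=.
by rewrite mcoeffD mcoeffZ scalerDl scalerA.
Qed.

HB.instance Definition _ := GRing.isLinear.Build Q {mpoly Q[N]} {mpoly Q[N]} _
  Chat Chat_is_linear.

Lemma Chat_monomial (m : 'X_{1..N}) : mdeg m = crit n d -> Chat 'X_[m] = lift_row d F m.
Proof.
move=> /mvalP[a <-]; rewrite /Chat (bigD1 a) //= mcoeffX eqxx scale1r big1 ?addr0 //.
by move=> b ba; rewrite mcoeffX (inj_eq (@mval_inj _ _)) eq_sym (negPf ba) scale0r.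
Qed.

(** On a monomial [Chat] replaces [x_i^d] with [i = fst_ge]. Replacing [x_j^d] instead changes the
    result by a multiple of [minor j i], so modulo the span the choice is immaterial. *)
Lemma Chat_shift e j (f : {mpoly Q[N]}) : (e + d)%N = crit n d -> f \is e.-homog ->
  syz_span (Chat ('X_j ^+ d * f) - f * F j).
Proof.
move=> he hf.
have -> : Chat ('X_j ^+ d * f) - f * F j =
    \sum_(v : mon N e) f@_(mval v) *:
      (Chat ('X_[upow j + mval v]) - 'X_[mval v] * F j).
  rewrite {1 2}(homog_expand hf) mulr_sumr raddf_sum mulr_suml -sumrB.
  apply: eq_bigr => v _.
  rewrite /= mpolyX_upow -scalerAr -mpolyXD.
  by rewrite linearZ /= scalerBr scalerAl.
apply: syz_span_sum => v.
have hm : mdeg (upow j + mval v)%MM = crit n d.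
  by rewrite mdegD mdeg_upow mdeg_mval addnC.
rewrite Chat_monomial // /lift_row; set i := fst_ge _ _.
have hi : (d <= (upow j + mval v)%MM i)%N := fst_geP d_gt0 hm.
have [ji|ji] := eqVneq j i.
  by rewrite ji addmC addmK subrr; apply: syz_span0.
move: hi; rewrite mnmDE upowE (negPf ji) add0n -upow_le => hi.
have -> : 'X_[upow j + mval v - upow i] * F i - 'X_[mval v] * F j =
    'X_[mval v - upow i] * minor d F j i.
  rewrite -[X in (upow j + X)%MM](submK hi) -[in X in _ - X](submK hi) addmA addmK.
  by rewrite !mpolyXD /minor !mpolyX_upow; ring.
apply: minor_syz_span; have := congr1 mdeg (submK hi).
by rewrite mdegD mdeg_upow mdeg_mval; lia.
Qed.

(** By [Chat_shift], the two terms of [x^g (x_p^d F_q - x_q^d F_p)] are both sent to [x^g F_p F_q]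
    modulo the span. *)
Lemma Chat_syz (a : T) : ~~ reduced d (mval a) -> syz_span (Chat (syz d F (mval a))).
Proof.
move=> na; have hm := mdeg_mval a; have /= sp := monomial_split d_gt0 hm na.
rewrite /syz; move: sp; set p := fst_ge _ _; set q := snd_ge _ _.
set g := (mval a - _ - _)%MM => sp.
have hg : (mdeg g + d + d)%N = crit n d.
  by rewrite -hm -[in RHS]sp !mdegD !mdeg_upow.
have hgF i : 'X_[g] * F i \is (mdeg g + d).-homog.
  by apply: dhomogM => //; rewrite dhomogX.
have -> : 'X_[g] * minor d F p q =
    'X_p ^+ d * ('X_[g] * F q) - 'X_q ^+ d * ('X_[g] * F p) by rewrite /minor; ring.
rewrite linearB /=.
have := syz_spanP (-1) (Chat_shift q hg (hgF p)) (Chat_shift p hg (hgF q)).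
congr (syz_span _); rewrite scaleN1r; ring.
Qed.

(** The cofactor is [\det J] for a [J] with [J Nmx = Tmx ('X - Cmx)]. On a nonreduced row both sides
    are ['X] times a [syz] minus its image under [Chat], which [Chat_syz] expands in the [syz]
    again. *)
Lemma det_Nmx_dvd : exists q,
  \det (Nmx d F) * q = \det (Tmx d F) *: char_poly (Cmx d F).
Proof.
have [H hH] : exists H : T -> T -> Q, forall a, ~~ reduced d (mval a) ->
    Chat (syz d F (mval a)) =
    \sum_(b : T | ~~ reduced d (mval b)) H a b *: syz d F (mval b).
  apply: (fin_all_exists (P := fun a (h : T -> Q) => ~~ reduced d (mval a) ->
    Chat (syz d F (mval a)) =
    \sum_(b : T | ~~ reduced d (mval b)) h b *: syz d F (mval b))) => a.
  case: (boolP (reduced d (mval a))) => [_|na]; first by exists (fun=> 0).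
  by have [h hE'] := Chat_syz na; exists h.
(* Identity on the reduced rows, ['X - H] on the nonreduced block. *)
pose J : 'M[{poly Q}]_#|T| := fmx (fun a b : T =>
  (a == b)%:R * (if reduced d (mval a) then 1 else 'X)
  - (if reduced d (mval a) || reduced d (mval b) then 0 else H a b)%:P).
have eJ : J *m Nmx d F = map_mx polyC (Tmx d F) *m char_poly_mx (Cmx d F).
  rewrite /char_poly_mx fmx1 !map_fmx.
  have -> : fmx (fun a b : T => 'X *+ (a == b)) -
      fmx (fun a b => ((lift_row d F (mval a))@_(mval b))%:P) =
      fmx (fun a b : T => (a == b)%:R * 'X - ((lift_row d F (mval a))@_(mval b))%:P).
    by apply/matrixP=> i j; rewrite !mxE mulr_natl.
  rewrite !fmxM; apply: eq_fmx => a b.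
  have delta (f : T -> {poly Q}) : \sum_c (a == c)%:R * f c = f a.
    rewrite (bigD1 a) //= eqxx mul1r big1 ?addr0 // => c ca.
    by rewrite eq_sym (negPf ca) mul0r.
  have delta' (f : T -> {poly Q}) : \sum_c f c * (c == b)%:R = f b.
    rewrite (bigD1 b) //= eqxx mulr1 big1 ?addr0 // => c ca.
    by rewrite (negPf ca) mulr0.
  case: (boolP (reduced d (mval a))) => [ra|nra].
    under eq_bigr do rewrite orTb subr0 mulr1; rewrite delta ra.
    under [RHS]eq_bigr do rewrite polyC_natr; rewrite delta.
    by rewrite -mul_polyC polyC_natr.
  under eq_bigr do rewrite orFb mulrBl -mulrA.
  rewrite sumrB delta (negPf nra).
  under [RHS]eq_bigr do rewrite mulrBr mulrA mulrAC.
  rewrite [RHS]sumrB delta' mulrC; congr (_ - _).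
  transitivity (((Chat (syz d F (mval a)))@_(mval b))%:P).
    rewrite hH // [in RHS]raddf_sum [RHS]rmorph_sum /= [RHS]big_mkcond.
    apply: eq_bigr => c _; case: ifP => _; rewrite ?mul0r //=.
    by rewrite mcoeffZ polyCM.
  rewrite /Chat [in LHS]raddf_sum [LHS]rmorph_sum /=; apply: eq_bigr => c _.
  by rewrite mcoeffZ polyCM.
exists (\det J); rewrite mulrC -det_mulmx eJ det_mulmx det_map_mx mul_polyC.
by [].
Qed.

End Field.

(** * Deformation to the generic case *)

Section Count.
Variables n d : nat.
Hypothesis d_gt0 : (0 < d)%N.
Local Notation N := n.+1.

Lemma map_Cmx (Z Z' : comNzRingType) (phi : {rmorphism Z -> Z'})
    (F : 'I_N -> {mpoly Z[N]}) :
  map_mx phi (Cmx d F) = Cmx d (fun i => map_mpoly phi (F i)).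
Proof.
rewrite map_fmx; apply: eq_fmx => a b.
by rewrite -map_lift_row mcoeff_map_mpoly.
Qed.

Lemma map_mpoly_homog (Z Z' : comNzRingType) (phi : {rmorphism Z -> Z'})
    e (f : {mpoly Z[N]}) : f \is e.-homog -> map_mpoly phi f \is e.-homog.
Proof.
move=> hf; apply/dhomogP => m; rewrite mcoeff_msupp mcoeff_map_mpoly => hm.
apply: (dhomogP _ _ _ hf); rewrite mcoeff_msupp; apply: contraNneq hm => ->.
by rewrite raddf0.
Qed.

(** Follows from [det_Nmx_dvd] over the fraction field, with denominators cleared to meet the
    hypotheses of [gauss_monic_factor2]. *)
Lemma det_Nmx_dvd_domain (Z : idomainType) (F : 'I_N -> {mpoly Z[N]}) :
  (forall i, F i \is d.-homog) -> \det (Emx d F) != 0 -> \det (Tmx d F) != 0 ->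
  exists a q, a != 0 /\ a *: char_poly (Cmx d F) = \det (Nmx d F) * q.
Proof.
move=> hF hE hT; pose FQ i := map_mpoly tofrac (F i).
have hFQ i : FQ i \is d.-homog by apply: map_mpoly_homog.
have hEQ : \det (Emx d FQ) != 0.
  by rewrite -[Emx d FQ](map_Emx d tofrac) det_map_mx tofrac_eq0.
have [q hq] := det_Nmx_dvd d_gt0 hFQ hEQ.
have [a [q' [a0 eq]]] := clear_denominators q.
exists (a * \det (Tmx d F)), q'; split; first by rewrite mulf_neq0.
have iI : injective (map_poly (@FracField.tofrac Z)).
  by apply: map_inj_poly (tofrac0 _) => x y /eqP; rewrite tofrac_eq => /eqP.
have iZ c (r : {poly Z}) : map_poly tofrac (c *: r) = tofrac c *: map_poly tofrac r.
  exact: map_polyZ.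
have iM (r s : {poly Z}) : map_poly tofrac (r * s) = map_poly tofrac r * map_poly tofrac s.
  exact: rmorphM.
have iN : map_poly tofrac (\det (Nmx d F)) = \det (Nmx d FQ) by apply: map_det_Nmx.
have iT : tofrac (\det (Tmx d F)) = \det (Tmx d FQ) by apply: map_det_Tmx.
have iC : map_poly tofrac (char_poly (Cmx d F)) = char_poly (Cmx d FQ).
  by rewrite -[Cmx d FQ](map_Cmx tofrac); apply: map_char_poly.
by apply: iI; rewrite iZ iM -eq iN iC -scalerAr hq scalerA -iT -tofracM.
Qed.

Section Generic.
Variables (R : numFieldType) (F : 'I_N -> {mpoly R[N]}).
Hypothesis hF : forall i, F i \is d.-homog.

(** The forms [i x_i^d], for which [Emx] and [Tmx] are known to be invertible. *)
Definition diag : 'I_N -> {mpoly R[N]} := split_form d 0 (fun=> 0).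
Definition pencil (G : 'I_N -> {mpoly R[N]}) i : {mpoly {poly R}[N]} :=
  map_mpoly polyC (F i) + 'X *: (map_mpoly polyC (G i) - map_mpoly polyC (F i)).

Lemma map_pencil G c i :
  map_mpoly (horner_eval c) (pencil G i) = F i + c *: (G i - F i).
Proof.
have e (f : {mpoly R[N]}) : map_mpoly (horner_eval c) (map_mpoly polyC f) = f.
  by apply/mpolyP=> m; rewrite !mcoeff_map_mpoly /= horner_evalE hornerC.
by rewrite /pencil rmorphD /= map_mpolyZ rmorphB /= !e horner_evalE hornerX.
Qed.

Lemma det_Tmx_pencil G : \det (Tmx d G) != 0 -> \det (Tmx d (pencil G)) != 0.
Proof.
apply: contraNneq => h; have := map_det_Tmx d (horner_eval (1 : R)) (pencil G).
rewrite h rmorph0 => e; apply/eqP; rewrite e; congr (\det (Tmx d _)).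
by apply/funext => i; rewrite map_pencil scale1r subrKC.
Qed.

Lemma pencil_homog G : (forall i, G i \is d.-homog) ->
  forall i, pencil G i \is d.-homog.
Proof.
by move=> hG i; rewrite rpredD ?rpredZ ?rpredB //; apply: map_mpoly_homog.
Qed.

Lemma pencil_eigen G lam (x : 'I_N -> R) : (forall i, x i != 0) ->
  (forall i, G i \is d.-homog) ->
  (forall i, (F i).@[x] = lam * x i ^+ d) -> (forall i, (G i).@[x] = lam * x i ^+ d) ->
  root (\det (Nmx d (pencil G))) lam%:P.
Proof.
move=> x0 hG eF eG; apply: (det_Nmx_root d_gt0 (x := fun i => (x i)%:P)).
- exact: pencil_homog.
- by move=> i; rewrite polyC_eq0.
have e (f : {mpoly R[N]}) : (map_mpoly polyC f).@[fun i => (x i)%:P] = f.@[x]%:P.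
  elim/mpolyind: f => [|c m f _ _ IH]; first by rewrite !rmorph0.
  rewrite rmorphD /= map_mpolyZ map_mpolyX !mevalD !mevalZ IH !mevalX rmorphD rmorphM /=.
  by rewrite rmorph_prod; under [in RHS]eq_bigr do rewrite rmorphXn.
by move=> i; rewrite mevalD mevalZ mevalB !e eF eG subrr mulr0 addr0 rmorphM rmorphXn.
Qed.

(** The inner variable is [t] and the outer one [u], as in [gauss_monic_factor2]. *)
Definition pencil2 (G : 'I_N -> {mpoly R[N]}) i : {mpoly {poly {poly R}}[N]} :=
  map_mpoly polyC (pencil diag i)
  + 'X *: map_mpoly (polyC \o polyC) (G i - F i).

Lemma map_pencil2_u0 G i : map_mpoly (horner_eval 0) (pencil2 G i) = pencil diag i.
Proof.
rewrite /pencil2 rmorphD /= map_mpolyZ /= [horner_eval 0 'X]hornerX scale0r addr0.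
by apply/mpolyP=> m; rewrite !mcoeff_map_mpoly /= horner_evalE hornerC.
Qed.

Lemma map_pencil2_t0 G i :
  map_mpoly (map_poly (horner_eval 0)) (pencil2 G i) = pencil G i.
Proof.
apply/mpolyP=> m; rewrite /pencil2 /pencil rmorphD /= map_mpolyZ /= map_polyX.
rewrite !(mcoeffD, mcoeffZ, mcoeff_map_mpoly, mcoeffB) /=.
rewrite !(map_polyC, rmorphB) /= !horner_evalE !hornerE /=.
by rewrite !mcoeffN mcoeff_map_mpoly /= polyCB.
Qed.

(* [g p0 = delta0 pi] along [F + t (diag - F)], where [g(0) <> 0]: up to a unit,
   [pi] is the polynomial function of the forms given by [p / delta]. *)
Lemma residual_factor lam (x : 'I_N -> R) : (forall i, x i != 0) ->
  (forall i, (F i).@[x] = lam * x i ^+ d) ->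
  exists (g : {poly R}) (pi : {poly {poly R}}),
    [/\ g.[0] != 0,
        g *: \det (Nmx d (pencil diag)) = \det (Tmx d (pencil diag)) *: pi
      & root (map_poly (horner_eval 0) pi) lam].
Proof.
move=> x0 eF.
pose G := split_form d lam (fun i => (x i / x ord0) ^+ d).
have hG i : G i \is d.-homog by apply: split_form_homog.
have hD i : diag i \is d.-homog by apply: split_form_homog.
have eG i : (G i).@[x] = lam * x i ^+ d.
  rewrite /G /split_form mevalD !mevalZ mevalB mevalZ !rmorphXn /= !mevalXU.
  by rewrite expr_div_n divfK ?expf_neq0 // subrr mulr0 addr0.
have hP i : pencil2 G i \is d.-homog.
  rewrite rpredD ?rpredZ //; first by apply/map_mpoly_homog/pencil_homog.
  by apply: map_mpoly_homog; apply: rpredB; [exact: hG|exact: hF].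
have dT0 : map_poly (horner_eval 0) (\det (Tmx d (pencil2 G))) != 0.
  rewrite (map_det_Tmx d (map_poly (horner_eval 0))) (_ : (fun i => _) = pencil G).
    exact/det_Tmx_pencil/det_Tmx_split_form.
  by apply/funext => i; rewrite map_pencil2_t0.
have dT : \det (Tmx d (pencil2 G)) != 0.
  by apply: contraNneq dT0 => ->; rewrite rmorph0.
have dE : \det (Emx d (pencil2 G)) != 0.
  (* At [u = 0], [t = 1] the family is [diag]. *)
  pose ev : {rmorphism {poly {poly R}} -> R} := horner_eval (1 : R) \o horner_eval (0 : {poly R}).
  have := det_Emx_split_form n d R; apply: contraNneq => h.
  have : ev (\det (Emx d (pencil2 G))) = 0 by rewrite h rmorph0.
  rewrite -det_map_mx map_Emx => e; apply/eqP; rewrite -[RHS]e.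
  congr (\det (Emx d _)); apply/funext => i.
  transitivity (map_mpoly (horner_eval 1) (map_mpoly (horner_eval 0) (pencil2 G i))).
    by rewrite map_pencil2_u0 map_pencil scale1r subrKC.
  by apply/mpolyP=> m; rewrite !mcoeff_map_mpoly.
have [a [q [a0 eq]]] := det_Nmx_dvd_domain hP dE dT.
set p := \det (Nmx d (pencil2 G)) in eq.
(* As [\det Tmx] is nonzero, the degree bound of [size_det_Nmx] is attained. *)
have lead_p : lead_coef p = \det (Tmx d (pencil2 G)).
  have [h1 h2] := size_det_Nmx d (pencil2 G); rewrite -h2 /lead_coef; congr (_`__).
  have h3 : (rank_red n d < size p)%N.
    by rewrite ltnNge; apply: contraNN dT => h; rewrite -h2 nth_default.
  by move: h1 h3; rewrite -/p; lia.
rewrite -lead_p in dT0.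
have [g [P [g0 eP]]] := gauss_monic_factor2 a0 (char_poly_monic _) eq dT0.
pose u0 : {poly {poly R}} -> {poly R} := horner_eval 0.
pose t0 : {poly {poly R}} -> {poly R} := map_poly (horner_eval 0).
have u0N : map_poly u0 p = \det (Nmx d (pencil diag)).
  rewrite (_ : pencil diag = fun i => map_mpoly u0 (pencil2 G i)); first exact: map_det_Nmx.
  by apply/funext => i; rewrite map_pencil2_u0.
have u0T : u0 (\det (Tmx d (pencil2 G))) = \det (Tmx d (pencil diag)).
  rewrite (_ : pencil diag = fun i => map_mpoly u0 (pencil2 G i)); first exact: map_det_Tmx.
  by apply/funext => i; rewrite map_pencil2_u0.
have t0N : map_poly t0 p = \det (Nmx d (pencil G)).
  rewrite (_ : pencil G = fun i => map_mpoly t0 (pencil2 G i)); first exact: map_det_Nmx.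
  by apply/funext => i; rewrite map_pencil2_t0.
have u0Z c (r : {poly {poly {poly R}}}) : map_poly u0 (c *: r) = u0 c *: map_poly u0 r.
  exact: map_polyZ.
have t0Z c (r : {poly {poly {poly R}}}) : map_poly t0 (c *: r) = t0 c *: map_poly t0 r.
  exact: map_polyZ.
have u0g : u0 g%:P = g by apply: hornerC.
exists g, (map_poly u0 P); split=> //.
  by rewrite -[in LHS]u0g -u0N -u0Z eP u0Z lead_p u0T.
(* On [t = 0] every member of the family has the eigenpair, so [p] vanishes at [lam]; there
   [lead_coef p] is nonzero and can be cancelled. *)
have root_t0 : root (map_poly t0 P) lam%:P.
  have /(congr1 (fun r => r.[lam%:P])) := congr1 (map_poly t0) eP.
  rewrite !t0Z t0N !hornerZ (eqP (pencil_eigen x0 hG eF eG)) mulr0 => /esym/eqP.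
  by rewrite mulf_eq0 (negPf dT0).
have r00 := congr1 (fun r => r.[0]) (eqP root_t0); rewrite horner0 in r00.
apply/eqP; rewrite -[RHS]r00.
(* The root, found on [t = 0], is carried to the restriction to [u = 0] through the common point
   [t = u = 0]. *)
have comm (c : {poly {poly R}}) : (u0 c).[0] = (t0 c).[0].
  by have := horner_map (horner_eval (0 : R)) c 0; rewrite rmorph0.
transitivity (map_poly (horner_eval 0) (map_poly t0 P)).[lam].
  rewrite -!map_poly_comp; congr (_.[_]); apply: eq_map_poly => c /=.
  exact: comm.
have := horner_map (horner_eval (0 : R)) (map_poly t0 P) lam%:P.
by rewrite /= !horner_evalE hornerC.
Qed.

(** [phi] is built from one eigenpair, if there is any, and compared with the polynomial that
    [residual_factor] attaches to any other. *)
Lemma eigenvalue_polynomial : exists phi : {poly R},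
  [/\ phi != 0, (size phi <= (rank_red n d).+1)%N &
   forall lam (x : 'I_N -> R), (forall i, x i != 0) ->
     (forall i, (F i).@[x] = lam * x i ^+ d) -> root phi lam].
Proof.
have [[lam0 [x0 [hx0 ex0]]]|none] := EM (exists lam (x : 'I_N -> R),
    (forall i, x i != 0) /\ (forall i, (F i).@[x] = lam * x i ^+ d)); last first.
  exists 1; rewrite oner_neq0 size_poly1; split=> // lam x hx ex.
  by case: none; exists lam, x.
have [g [pi [g0 e _]]] := residual_factor hx0 ex0.
set p0 := \det (Nmx d _) in e; set d0 := \det (Tmx d _) in e.
have d00 : d0 != 0 by apply/det_Tmx_pencil/det_Tmx_split_form.
have [sp cp] := size_det_Nmx d (pencil diag); rewrite -/p0 -/d0 in sp cp.
have gn : g != 0 by apply: contraNneq g0 => ->; rewrite horner0.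
exists (map_poly (horner_eval 0) pi); split.
(* The coefficient of [pi] at [rank_red n d] is [g], since that of [p0] is [d0]; it does not vanish
   at [t = 0]. *)
- apply: contraNneq g0 => h.
  have := congr1 (fun q : {poly {poly R}} => q`_(rank_red n d)) e.
  rewrite !coefZ cp mulrC => /(mulfI d00) ->.
  by have := congr1 (fun q : {poly R} => q`_(rank_red n d)) h; rewrite coef_map coef0 /= horner_evalE => ->.
- apply: leq_trans (size_poly _ _) _.
  suff -> : size pi = size p0 by [].
  by rewrite -(size_scale p0 gn) e size_scale.
(* [p0] and [d0] do not involve the eigenpair, whence [g1 pi = g pi1]. At [t = 0] the right side
   vanishes at [lam], and [g1(0)] is nonzero. *)
move=> lam x hx ex; have [g1 [pi1 [g10 e1 r1]]] := residual_factor hx ex.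
rewrite -/p0 -/d0 in e1.
have : g1 *: pi = g *: pi1.
  apply: (polyZI d00); rewrite scalerA mulrC -scalerA -e scalerA mulrC -scalerA e1.
  by rewrite !scalerA mulrC.
move/(congr1 (map_poly (horner_eval (0 : R)))); rewrite !map_polyZ /=.
move/(congr1 (horner_eval lam)); rewrite !horner_evalE !hornerZ (eqP r1) mulr0 => /eqP.
by rewrite mulf_eq0 (negPf g10).
Qed.

End Generic.
End Count.

(** * Counting over supports *)

(** A reduced monomial is determined by its index [fst_ge] and its [n] other exponents, all below
    [d]; the degree fixes the remaining one. *)
Lemma rank_red_le n d : (0 < d)%N -> (rank_red n d <= n.+1 * d ^ n)%N.
Proof.
case: d => // d _.
pose f (a : mon n.+1 (crit n d.+1)) := (fst_ge d.+1 (mval a),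
  [ffun i : 'I_n => inord (mval a (lift (fst_ge d.+1 (mval a)) i)) : 'I_d.+1]).
have fI : {in [pred a : mon n.+1 (crit n d.+1) | reduced d.+1 (mval a)] &, injective f}.
  move=> a b; rewrite !inE => /forallP ra /forallP rb [ep /ffunP ef].
  apply: mval_inj; apply/mnmP.
  have off i : i != fst_ge d.+1 (mval a) -> mval a i = mval b i.
    move=> ip; case: (unliftP (fst_ge d.+1 (mval a)) i) => [j ij|/eqP]; last by rewrite (negPf ip).
    have := ra i; rewrite ip /= => la; have := rb i; rewrite -ep ip /= => lb.
    have := ef j; rewrite !ffunE -ep -ij => /(congr1 val) /=.
    by rewrite !inordK.
  move=> i; have [->|] := eqVneq i (fst_ge d.+1 (mval a)); last exact: off.
  have := etrans (mdeg_mval a) (esym (mdeg_mval b)); rewrite !mdegE.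
  rewrite (bigD1 (fst_ge d.+1 (mval a))) //= [RHS](bigD1 (fst_ge d.+1 (mval a))) //=.
  by rewrite (eq_bigr (fun i => mval b i)) => [/addIn|j jp]; last exact: off.
have -> : (n.+1 * d.+1 ^ n)%N = #|{: 'I_n.+1 * {ffun 'I_n -> 'I_d.+1}}|.
  by rewrite card_prod card_ffun !card_ord.
by rewrite /rank_red -(card_in_imset fI) max_card.
Qed.

Section Support.
Variables (R : realType) (m n : nat) (A : tensor R m n) (J : {set 'I_n}) (k : nat).
Hypotheses (hm : (2 <= m)%N) (hJ : #|J| = k.+1).

Definition support_enum (i : 'I_k.+1) : 'I_n := enum_val (cast_ord (esym hJ) i).

(** The variable attached to [j] if [j] is in [J]; otherwise the sum is empty and the coordinate is
    set to 0. *)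
Definition support_var (j : 'I_n) : {mpoly R[k.+1]} :=
  \sum_(i | support_enum i == j) 'X_i.

Definition support_form (i : 'I_k.+1) : {mpoly R[k.+1]} :=
  \sum_(t : m.-tuple 'I_n | ohead t == Some (support_enum i))
    A t *: \prod_(j <- behead t) support_var j.

Lemma support_form_homog i : support_form i \is (m - 1).-homog.
Proof.
apply: rpred_sum => t _; apply: rpredZ.
have <- : size (behead t) = (m - 1)%N by rewrite size_behead size_tuple subn1.
elim: (behead t) => [|j s IH]; first by rewrite big_nil dhomog1.
rewrite big_cons -[size _]/(1 + size s)%N; apply: dhomogM => //.
by apply: rpred_sum => l _; rewrite dhomogX /= mdeg1.
Qed.

Lemma support_form_eval (x : 'cV[R]_n) i : (forall j, j \notin J -> x j 0 = 0) ->
  (support_form i).@[fun l => x (support_enum l) 0] = tensor_app A x (support_enum i) 0.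
Proof.
move=> hx; rewrite mxE raddf_sum /=; apply: eq_bigr => t _.
rewrite mevalZ rmorph_prod /=; congr (_ * _); apply: eq_bigr => j _.
rewrite raddf_sum /=; under eq_bigr do rewrite mevalXU.
have [jJ|jJ] := boolP (j \in J).
  have h : support_enum (cast_ord hJ (enum_rank_in jJ j)) = j.
    by rewrite /support_enum cast_ordK enum_rankK_in.
  rewrite (big_pred1 (cast_ord hJ (enum_rank_in jJ j))) ?h // => l.
  rewrite /= -[in LHS]h; apply: inj_eq => a b /enum_val_inj /cast_ord_inj; exact.
rewrite hx // big_pred0 // => l; apply: contraNF jJ => /eqP <-; exact: enum_valP.
Qed.

Lemma support_polynomial : exists phi : {poly R},
  [/\ phi != 0, (size phi <= (k.+1 * (m - 1) ^ k).+1)%N &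
   forall lambda (x : 'cV[R]_n), (forall j, (x j 0 != 0) = (j \in J)) ->
     (forall j, j \in J -> tensor_app A x j 0 = lambda * x j 0 ^+ (m - 1)) ->
     root phi lambda].
Proof.
have d0 : (0 < m - 1)%N by lia.
have [phi [p0 sp hp]] := eigenvalue_polynomial d0 support_form_homog.
exists phi; split=> //.
  by apply: leq_trans sp _; rewrite ltnS rank_red_le.
have inJ i : support_enum i \in J by apply: enum_valP.
move=> lambda x hx ex; apply: (hp _ (fun l => x (support_enum l) 0)) => i.
  by rewrite hx.
rewrite support_form_eval ?ex // => j jJ.
by apply/eqP; move: jJ; rewrite -hx negbK.
Qed.

End Support.

Lemma pareto_support (R : realType) (m n : nat) (A : tensor R m n) (J0 : {set 'I_n})
    (lambda : R) : (2 <= m)%N -> positive_off A J0 -> pareto_eigenvalue A lambda ->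
  exists (J : {set 'I_n}) (x : 'cV[R]_n),
    [/\ J0 \subset J, J != set0, forall j, (x j 0 != 0) = (j \in J) &
        forall j, j \in J -> tensor_app A x j 0 = lambda * x j 0 ^+ (m - 1)].
Proof.
move=> hm hA [x [x0 xge yge xy]].
exists [set j | x j 0 != 0], x.
have yE j : (lambda *: vpow (m := m) x - tensor_app A x) j 0 =
    lambda * x j 0 ^+ (m - 1) - tensor_app A x j 0 by rewrite !mxE.
have [j1 xj1] : exists j, x j 0 != 0.
  apply: contrapT => h; case/negP: x0; apply/eqP/colP=> j; rewrite mxE.
  by apply: contrapT => hj; apply: h; exists j; apply/eqP.
(* The inner product is a vanishing sum of nonnegative terms, so each term is 0. *)
have comp j : x j 0 != 0 -> tensor_app A x j 0 = lambda * x j 0 ^+ (m - 1).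
  move=> xj; have /eqP := xy; rewrite /inner psumr_eq0 => [/allP h|i _]; last first.
    exact: mulr_ge0 (xge i) (yge i).
  have := h j (mem_index_enum _); rewrite /= mulf_eq0 (negPf xj) /= yE subr_eq0.
  by move/eqP.
split.
- apply/subsetP=> i iJ0; rewrite inE; apply/negP=> /eqP xi.
  have := yge i; rewrite yE xi expr0n subn_eq0 leqNgt hm /= mulr0 sub0r oppr_ge0.
  apply/negP; rewrite -ltNge mxE.
  (* A term with [i] among its later indices vanishes since [x_i = 0]; in the others the entry is
     positive. *)
  have ge0 (t : m.-tuple 'I_n) : ohead t == Some i ->
      0 <= A t * \prod_(j <- behead t) x j 0.
    move=> /eqP ht; have [iin|inot] := boolP (i \in behead t).
      suff -> : \prod_(j <- behead t) x j 0 = 0 by rewrite mulr0.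
      by apply/eqP; rewrite prodf_seq_eq0; apply/hasP; exists i; rewrite ?xi ?eqxx.
    apply: mulr_ge0; first exact: ltW (hA _ _ iJ0 ht inot).
    by apply: prodr_ge0 => j _; apply: xge.
  (* The term of [(i, j1, ..., j1)] is positive, since [x_j1 > 0] and hence [j1] differs from
     [i]. *)
  have st : size (i :: nseq (m - 1) j1) == m by rewrite /= size_nseq; apply/eqP; lia.
  rewrite (bigD1 (Tuple st)) //= ltr_pwDl //; last first.
    by apply: sumr_ge0 => t /andP[ht _]; apply: ge0.
  rewrite mulr_gt0 //.
    apply: (hA i) => //=; rewrite mem_nseq negb_and; apply/orP; right.
    by apply: contraNneq xj1 => <-; rewrite xi.
  rewrite big_seq; apply: prodr_gt0 => j; rewrite mem_nseq => /andP[_ /eqP->].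
  by rewrite lt_def xj1; apply: xge.
- by apply/set0Pn; exists j1; rewrite inE.
- by move=> j; rewrite inE.
- by move=> j; rewrite inE; apply: comp.
Qed.

(** * Evaluation of the sum over supersets of [J0], and the final count *)

Lemma sum_supersets (V : nmodType) (T : finType) (J0 : {set T}) (g : nat -> V) :
  \sum_(J : {set T} | J0 \subset J) g #|J| =
  \sum_(j < (#|T| - #|J0|).+1) g (#|J0| + j)%N *+ 'C(#|T| - #|J0|, j).
Proof.
(* Supersets of [J0] correspond to subsets [K] of its complement, which are then grouped by size. *)
rewrite (reindex_onto (fun K => J0 :|: K) (fun J => J :\: J0)) /=; last first.
  by move=> J JJ; rewrite setDE setUIr setUCr setIT; apply/setUidPr.
have cC : #|~: J0| = (#|T| - #|J0|)%N by rewrite cardsCs setCK.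
have P K : (J0 \subset J0 :|: K) && ((J0 :|: K) :\: J0 == K) = (K \subset ~: J0).
  rewrite subsetUl /= setDUl setDv set0U; apply/eqP/idP => [<-|]; first by rewrite setDE subsetIr.
  by move=> /setIidPl {2}<-; rewrite setDE.
set N := (#|T| - #|J0|)%N in cC *.
have le (K : {set T}) : K \subset ~: J0 -> (#|K| < N.+1)%N by move=> sK; rewrite ltnS -cC; apply: subset_leq_card.
rewrite (eq_bigl _ _ P) (partition_big (fun K : {set T} => inord #|K| : 'I_N.+1) predT) //=.
apply: eq_bigr => j _.
have <- : #|[set K : {set T} | K \subset ~: J0 & #|K| == j]| = 'C(N, j).
  by rewrite cards_draws cC.
rewrite -sumr_const; apply: eq_big => K.
  by rewrite inE; apply: andb_id2l => sK; rewrite -val_eqE /= inordK // le.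
move=> /andP[sK /eqP <-]; rewrite inordK ?le //.
congr g; rewrite cardsU; suff -> : J0 :&: K = set0 by rewrite cards0 subn0.
by apply/setP=> i; rewrite !inE; apply/negP=> /andP[i0 iK]; have := subsetP sK i iK; rewrite inE i0.
Qed.

(** The absorption identity [(j + 1) C(N + 1, j + 1) = (N + 1) C(N, j)] reduces it to the binomial
    theorem. *)
Lemma sum_binomial_weighted (F : fieldType) (c : F) N :
  \sum_(j < N.+1) (j%:R * c ^+ j) *+ 'C(N, j) = N%:R * c * (1 + c) ^+ N.-1.
Proof.
case: N => [|N]; first by rewrite big_ord1 !mul0r mul0rn.
rewrite big_ord_recl mul0r mul0rn add0r /= exprDn mulr_sumr.
apply: eq_bigr => j _; rewrite expr1n mul1r /bump /= add1n exprS.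
have h : 'C(N.+1, j.+1)%:R * j.+1%:R = N.+1%:R * 'C(N, j)%:R :> F.
  by rewrite -!natrM mulnC -mul_bin_diag.
rewrite -[LHS]mulr_natl mulrA h -[c ^+ j *+ _]mulr_natl.
by move: ('C(N, j)%:R) (N.+1%:R) (c ^+ j) => u v w; ring.
Qed.

(** With [c = m - 1] and [N = n - l], both sides equal [c^(l-1) (l (1 + c)^N + N c (1 +
    c)^(N-1))]. *)
Lemma gammaE m n l : (2 <= m)%N -> (l <= n)%N ->
  gamma m n l = \sum_(j < (n - l).+1) ((l + j)%N%:R * (m%:R - 1) ^ ((l + j)%N%:Z - 1)) *+ 'C(n - l, j).
Proof.
move=> hm ln; set c : rat := m%:R - 1; set N := (n - l)%N.
have c0 : c != 0 by rewrite subr_eq0 pnatr_eq1; lia.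
have m0 : (m%:R : rat) != 0 by rewrite pnatr_eq0; lia.
have mE : m%:R = 1 + c by rewrite /c; ring.
have nE : (n%:R : rat) = l%:R + N%:R by rewrite -natrD /N subnKC.
have e (a : rat) (k : nat) : a != 0 -> a ^ (k%:Z - 1) = a ^+ k / a.
  by move=> a0; rewrite expfzDr // expr1z_inv.
have S0 : \sum_(j < N.+1) c ^+ j *+ 'C(N, j) = (1 + c) ^+ N.
  by rewrite exprDn; apply: eq_bigr => j _; rewrite expr1n mul1r.
transitivity (c ^+ l / c * (l%:R * (1 + c) ^+ N + N%:R * c * (1 + c) ^+ N.-1)).
  have c1 : 1 + c != 0 by rewrite -mE.
  rewrite /gamma -/c subzn // !e // mE nE -/N.
  move: (N) (c ^+ l) => [|N'] u /=; first by rewrite expr0; field; rewrite c0 c1.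
  by rewrite !exprS; field; rewrite c0 c1.
rewrite -sum_binomial_weighted -S0 mulr_sumr -big_split mulr_sumr; apply: eq_bigr => j _ /=.
rewrite e // -[RHS]mulr_natl -[c ^+ j *+ _]mulr_natl -[_ * c ^+ j *+ _]mulr_natl natrD exprD.
by move: ('C(N, j)%:R) (l%:R) (j%:R) (c ^+ l) (c ^+ j) => u v w p q; ring.
Qed.

Lemma at_most_elements_roots (R : realType) (S : classical_sets.set R) (p : {poly R}) D :
  p != 0 -> (size p <= D.+1)%N -> (forall x, S x -> root p x) ->
  at_most_elements S D%:R.
Proof.
move=> p0 sp hS.
have bound (s : seq R) : uniq s -> (forall x, x \in s -> S x) -> (size s <= D)%N.
  move=> us sS; rewrite -ltnS; apply: leq_trans sp; apply: max_poly_roots => //.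
  by apply/allP=> x /sS /hS.
have fS : cardinality.finite_set S.
  apply: contrapT => /(cardinality.infinite_set_fset D.+1)[B BS hB].
  have : (#|` B|%fset <= D)%N by apply: bound => [|x xB]; [exact: fset_uniq|exact: BS].
  by rewrite leqNgt hB.
split=> //; rewrite ler_nat; apply: bound; first exact: fset_uniq.
by move=> x; rewrite cardinality.in_fset_set // classical_sets.in_setE.
Qed.

(** At [k = 0] the exponent truncates to 0, but the factor [k] makes the value 0: the empty support
    contributes nothing. *)
Definition degree_bound m k : nat := (k * (m - 1) ^ (k - 1))%N.

Lemma sum_degree_bound m n (J0 : {set 'I_n}) : (2 <= m)%N ->
  (\sum_(J : {set 'I_n} | J0 \subset J) degree_bound m #|J|)%N%:R = gamma m n #|J0|.
Proof.
move=> hm; rewrite gammaE //; last by rewrite -[n in (_ <= n)%N]card_ord max_card.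
rewrite natr_sum (sum_supersets J0 (fun k => (degree_bound m k)%:R)) card_ord.
apply: eq_bigr => j _; congr (_ *+ _); rewrite /degree_bound.
case: (#|J0| + j)%N => [|k]; first by rewrite !mul0r.
rewrite natrM natrX natrB; last by lia.
by rewrite subzn // -exprnP.
Qed.

Theorem proposition4p4 (R : realType) (m n : nat) (hm : (2 <= m)%N)
  (hn : (1 <= n)%N) (A : tensor R m n) (l : nat) (J0 : {set 'I_n})
  (hJ0 : #|J0| = l) (hA : positive_off A J0) :
  at_most_elements (pareto_spectrum A) (gamma m n l) /\
  (J0 = [set: 'I_n]%SET -> at_most_elements (pareto_spectrum A) (mu m n)%:R%R).
Proof.
have main : at_most_elements (pareto_spectrum A) (gamma m n l).
  have [phi hphi] : exists phi : {set 'I_n} -> {poly R}, forall J : {set 'I_n},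
    [/\ phi J != 0, (size (phi J) <= (degree_bound m #|J|).+1)%N &
      forall lambda (x : 'cV[R]_n), J != set0 ->
        (forall j, (x j 0 != 0) = (j \in J)) ->
        (forall j, j \in J -> tensor_app A x j 0 = lambda * x j 0 ^+ (m - 1)) ->
        root (phi J) lambda].
    apply: (fin_all_exists (P := fun (J : {set 'I_n}) (p : {poly R}) =>
      [/\ p != 0, (size p <= (degree_bound m #|J|).+1)%N & forall lambda (x : 'cV[R]_n),
        J != set0 -> (forall j, (x j 0 != 0) = (j \in J)) ->
        (forall j, j \in J -> tensor_app A x j 0 = lambda * x j 0 ^+ (m - 1)) ->
        root p lambda])) => J.
    (* An empty support contradicts [J != set0], so the constant 1 serves. *)
    case cJ: #|J| => [|k].
      exists 1; rewrite oner_neq0 size_poly1; split=> // lambda x.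
      by rewrite -card_gt0 cJ.
    have [p [p0 sp hp]] := support_polynomial A hm cJ; exists p; split=> //.
      by rewrite /degree_bound subSS subn0.
    by move=> lambda x _; apply: hp.
  pose s := [seq J : {set 'I_n} <- index_enum _ | J0 \subset J].
  have sphi J : (size (phi J) <= (degree_bound m #|J|).+1)%N by have [] := hphi J.
  have [sz _] := size_prod_top s sphi.
  rewrite -hJ0 -(sum_degree_bound J0 hm).
  apply: (at_most_elements_roots (p := \prod_(J <- s) phi J)).
  - by rewrite prodf_seq_neq0; apply/allP=> J _; have [-> _ _] := hphi J.
  - by move: sz; rewrite [in X in (_ <= X)%N]big_filter.
  move=> lambda /(pareto_support hm hA)[J [x [J0J Jn0 hx ex]]].
  rewrite rootE horner_prod prodf_seq_eq0; apply/hasP; exists J.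
    by rewrite mem_filter J0J mem_index_enum.
  by have [_ _ /(_ lambda x Jn0 hx ex)] := hphi J.
(* The full set has itself as its only superset, so the sum has a single term. *)
split=> // J0T; suff -> : (mu m n)%:R = gamma m n l by [].
rewrite -hJ0 -(sum_degree_bound J0 hm) J0T (big_pred1 [set: 'I_n]%SET) => [|J].
  by rewrite cardsT card_ord.
by rewrite subTset.
Qed.
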